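(* Run Expected TD-PMD (defined in the context) with $K\ge1$ and behavior policy $\pi_b$. Assume (i) $\tilde\pi_b:=\min_{(s,a)}\pi_b(a|s)>0$; (ii) the state transition matrix $P^{\pi_b}_{\mathcal S}$ is ergodic over $\mathcal S$. Let $\alpha_k=\alpha\in(0,1]$ for all $k$, let the policy step sizes satisfy $$\eta_k\ge\eta\cdot\|D^{\tilde\pi_k}_{\pi_k}\|_\infty\quad\text{with }\eta>0,$$ where $\tilde\pi_k$ is any policy with $\langle\tilde\pi_k(\cdot|s),Q^k(s,\cdot)\rangle=\max_aQ^k(s,a)$ for all $s$, and let $c_t^k=1/B_k$. Then $$\mathbb E\big[\|Q^*-Q^{\pi_K}\|_\infty\big]\le\frac{2}{\alpha\tilde\sigma_b(1-\gamma)^2}[1-(1-\gamma)\alpha\tilde\sigma_b]^{K-1}+\frac{2\gamma}{\alpha\eta(1-\gamma)^2\tilde\sigma_b^2}+\frac{1}{\tilde\sigma_b(1-\gamma)}\left(\frac{4|\mathcal S||\mathcal A|}{(1-\gamma)^2}\Big(1+\frac{m_b}{1-\kappa_b}\Big)\right)^{1/2}\Big(\Xi(K)+\Xi(K-1)+(B_{K-1})^{-1/2}\Big),$$ where $\Xi(t):=\sum_{k=0}^{t-1}[1-(1-\gamma)\alpha\tilde\sigma_b]^{t-1-k}(B_k)^{-1/2}$.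
   Context: MDP: $\mathcal S,\mathcal A$ are finite nonempty sets, $P(\cdot|s,a)\in\Delta(\mathcal S)$ is the transition kernel, $r:\mathcal S\times\mathcal A\to[0,1]$ the reward, $\gamma\in[0,1)$ the discount factor; $\Delta(X)$ is the set of probability distributions on $X$. A policy is $\pi:\mathcal S\to\Delta(\mathcal A)$; $\Pi$ is the set of all policies. $Q^\pi(s,a)=\mathbb E[\sum_{t\ge0}\gamma^t r(s_t,a_t)\mid s_0=s,a_0=a,\pi]$ and $Q^*(s,a)=\max_{\pi\in\Pi}Q^\pi(s,a)$. Mirror map: $h$ is a proper, closed, strictly convex, essentially smooth function on $\mathbb R^{|\mathcal A|}$, finite on $\Delta(\mathcal A)$, with $\mathrm{rint\,dom}\,h\cap\Delta(\mathcal A)\neq\emptyset$. $D_h(p\|q)=h(p)-h(q)-\langle\nabla h(q),p-q\rangle$; $D^{\pi}_{\pi'}(s)=D_h(\pi(\cdot|s)\|\pi'(\cdot|s))$, $D^{p}_{\pi'}(s)=D_h(p\|\pi'(\cdot|s))$, $\|D^\pi_{\pi'}\|_\infty=\max_s D^\pi_{\pi'}(s)$. The initial policy satisfies $\pi_0(\cdot|s)\in\mathrm{rint\,dom}\,h$ for all $s$. Expected TD-PMD. Inputs: $K$, a behavior policy $\pi_b$, $Q^0=0\in\mathbb R^{|\mathcal S||\mathcal A|}$, $\pi_0$, critic step sizes $\alpha_k$, policy step sizes $\eta_k>0$ (which may depend on $\pi_k,Q^k$), initial state $s_0$, deterministic batch sizes $B_k$ (positive integers), weights $c_t^k\ge0$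 with $\sum_{t=0}^{B_k-1}c^k_t=1$. Set $s_0^0=s_0$. For $k=0,1,\dots,K$: (1) for every $s$, $\pi_{k+1}(\cdot|s)=\arg\max_{p\in\Delta(\mathcal A)}\{\eta_k\langle p,Q^k(s,\cdot)\rangle-D^p_{\pi_k}(s)\}$; (2) starting from $s_0^k$ sample, for $t=0,\dots,B_k-1$, $a_t^k\sim\pi_b(\cdot|s_t^k)$, $r_t^k=r(s_t^k,a_t^k)$, $s_{t+1}^k\sim P(\cdot|s_t^k,a_t^k)$, and set $s_0^{k+1}=s_{B_k}^k$; (3) with $\delta_t^k(s,a)=\mathbf 1_{(s_t^k,a_t^k)=(s,a)}\big[r_t^k+\gamma\,\mathbb E_{a'\sim\pi_{k+1}(\cdot|s_{t+1}^k)}[Q^k(s_{t+1}^k,a')]-Q^k(s_t^k,a_t^k)\big]$ and $\bar\delta_k=\sum_{t=0}^{B_k-1}c_t^k\delta_t^k$, set $Q^{k+1}=Q^k+\alpha_k\bar\delta_k$. Behavior chain: $P^{\pi_b}_{\mathcal S}(s,s')=\sum_a\pi_b(a|s)P(s'|s,a)$. When it is ergodic (irreducible and aperiodic) it has a unique stationary distribution $\nu^{\pi_b}$, all of whose entries are positive, and there are constants $m_b>0$, $\kappa_b\in(0,1)$ such that the induced Markov chain $\{s_t\}$ satisfies $d_{TV}(\nu^{\pi_b},\mathbb P(s_{n+t}=\cdot\mid s_n=s))\le m_b\kappa_b^t$ for all $s$, $n,t\ge0$ ($d_{TV}$ = total variation distance); $m_b,\kappa_b$ denote such constants. $\sigma^{\pi_b}(s,a)=\nu^{\pi_b}(s)\pi_b(a|s)$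 and $\tilde\sigma_b=\min_{s,a}\sigma^{\pi_b}(s,a)>0$. *)

(* Defs.v *)
From HB Require Import structures.
From mathcomp Require Export all_boot all_order all_algebra.
From mathcomp Require Export all_classical all_reals all_analysis.
Export numFieldNormedType.Exports.
Set Implicit Arguments.
Unset Strict Implicit.
Unset Printing Implicit Defensive.
Export Order.TTheory GRing.Theory Num.Theory.

Local Open Scope classical_set_scope.
Local Open Scope ring_scope.

(* On a nonempty finite type these are the maximum and the minimum: the range
   is finite and nonempty, so the sup and the inf are attained. *)
Definition maxf (R : realType) (T : finType) (f : T -> R) : R := sup (range f).
Definition minf (R : realType) (T : finType) (f : T -> R) : R := inf (range f).

Definition infnorm (R : realType) (T : finType) (f : T -> R) : R :=
  maxf (fun x => `|f x|).

Definition is_dist (R : realType) (T : finType) (p : T -> R) : Prop :=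
  (forall x, 0 <= p x) /\ \sum_x p x = 1.

Definition dTV (R : realType) (T : finType) (p q : T -> R) : R :=
  2^-1 * \sum_x `|p x - q x|.

Record mdp (R : realType) (S A : finType) := Mdp {
  transition : S -> A -> S -> R ;
  reward : S -> A -> R ;
  discount : R ;
  transition_dist : forall s a, is_dist (transition s a) ;
  reward_itv : forall s a, 0 <= reward s a <= 1 ;
  discount_itv : 0 <= discount < 1 }.

Definition is_policy (R : realType) (S A : finType) (pi : S -> A -> R) : Prop :=
  forall s, is_dist (pi s).

(* The event that s_0, .., s_n is x 0, .., x n and a_0, .., a_(n-1) is
   y 0, .., y (n-1), i.e. the history up to the moment where a_n is chosen. *)
Definition history (Omega : Type) (S A : finType) (s : nat -> Omega -> S)
    (a : nat -> Omega -> A) (n : nat) (x : nat -> S) (y : nat -> A) : set Omega :=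
  [set w | (forall i, (i <= n)%N -> s i w = x i) /\
           (forall i, (i < n)%N -> a i w = y i)].

(* a_n ~ pi(.|s_n), conditionally on the history; the conditional probability
   is written multiplicatively so that null histories need no convention. *)
Definition samples_action (R : realType) (d : measure_display)
    (Omega : measurableType d) (Pr : probability Omega R) (S A : finType)
    (pi : S -> A -> R) (s : nat -> Omega -> S) (a : nat -> Omega -> A)
    (n : nat) : Prop :=
  forall (x : nat -> S) (y : nat -> A),
    (Pr (history s a n x y `&` [set w | a n w = y n])
     = Pr (history s a n x y) * (pi (x n) (y n))%:E)%E.

(* s_(n+1) ~ P(.|s_n, a_n), conditionally on the history and a_n. *)
Definition samples_state (R : realType) (d : measure_display)
    (Omega : measurableType d) (Pr : probability Omega R) (S A : finType)
    (M : mdp R S A) (s : nat -> Omega -> S) (a : nat -> Omega -> A)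
    (n : nat) : Prop :=
  forall (x : nat -> S) (y : nat -> A),
    (Pr (history s a n.+1 x y)
     = Pr (history s a n x y `&` [set w | a n w = y n])
       * (transition M (x n) (y n) (x n.+1))%:E)%E.

Definition is_random_elt (d : measure_display) (Omega : measurableType d)
    (T : finType) (X : Omega -> T) : Prop :=
  forall x, measurable [set w | X w = x].

(* (s_t, a_t) is the process started at (s0, a0) and then driven by pi. *)
Definition policy_process (R : realType) (S A : finType) (M : mdp R S A)
    (pi : S -> A -> R) (s0 : S) (a0 : A) (d : measure_display)
    (Omega : measurableType d) (Pr : probability Omega R)
    (s : nat -> Omega -> S) (a : nat -> Omega -> A) : Prop :=
  [/\ forall n, is_random_elt (s n) /\ is_random_elt (a n),
      forall w, s 0%N w = s0 /\ a 0%N w = a0,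
      forall n, samples_state Pr M s a n &
      forall n, samples_action Pr pi s a n.+1].

Definition discounted_return (R : realType) (S A : finType) (M : mdp R S A)
    (s : nat -> S) (a : nat -> A) : R :=
  limn (series (fun t => discount M ^+ t * reward M (s t) (a t))).

(* q is the expected discounted return E[ .. | s_0 = s0, a_0 = a0, pi]. *)
Definition is_action_value (R : realType) (S A : finType) (M : mdp R S A)
    (pi : S -> A -> R) (s0 : S) (a0 : A) (q : R) : Prop :=
  exists (d : measure_display) (Omega : measurableType d)
         (Pr : probability Omega R)
         (s : nat -> Omega -> S) (a : nat -> Omega -> A),
    policy_process M pi s0 a0 Pr s a /\
    ('E_Pr[fun w => discounted_return M (s ^~ w) (a ^~ w)] = q%:E)%E.

(* For a policy pi exactly one q satisfies is_action_value: the process exists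
   (Ionescu-Tulcea) and its law determines the expectation. *)
Definition Qval (R : realType) (S A : finType) (M : mdp R S A)
    (pi : S -> A -> R) (s : S) (a : A) : R :=
  get [set q | is_action_value M pi s a q].

(* The values lie in [0, 1 / (1 - gamma)] and the supremum is attained. *)
Definition Qstar (R : realType) (S A : finType) (M : mdp R S A)
    (s : S) (a : A) : R :=
  sup [set Qval M pi s a | pi in [set pi | is_policy pi]].

Definition state_kernel (R : realType) (S A : finType) (M : mdp R S A)
    (pi : S -> A -> R) (s s' : S) : R :=
  \sum_a pi s a * transition M s a s'.

(* The t-step transition probabilities P(s_(n+t) = s' | s_n = s). *)
Fixpoint nstep (R : realType) (S : finType) (P : S -> S -> R) (t : nat)
    (s s' : S) : R :=
  if t is u.+1 then \sum_s1 nstep P u s s1 * P s1 s' else (s == s')%:R.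

Definition irreducible_chain (R : realType) (S : finType) (P : S -> S -> R) :
    Prop :=
  forall s s', exists t, 0 < nstep P t s s'.

(* gcd {t >= 1 | P^t(s, s) > 0} = 1 for every s. *)
Definition aperiodic_chain (R : realType) (S : finType) (P : S -> S -> R) :
    Prop :=
  forall (s : S) (e : nat),
    (forall t, (0 < t)%N -> 0 < nstep P t s s -> (e %| t)%N) -> e = 1%N.

Definition ergodic_chain (R : realType) (S : finType) (P : S -> S -> R) : Prop :=
  irreducible_chain P /\ aperiodic_chain P.

Definition is_stationary (R : realType) (S : finType) (P : S -> S -> R)
    (nu : S -> R) : Prop :=
  is_dist nu /\ forall s', \sum_s nu s * P s s' = nu s'.

Definition dot (R : realType) (n : nat) (u v : 'rV[R]_n) : R :=
  \sum_i u ord0 i * v ord0 i.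

Definition grad (R : realType) (n : nat) (f : 'rV[R]_n -> R) (x : 'rV[R]_n) :
    'rV[R]_n :=
  \row_i 'D_(delta_mx ord0 i) f x.

Definition dom (R : realType) (n : nat) (h : 'rV[R]_n -> \bar R) :
    set 'rV[R]_n :=
  [set x | (h x < +oo)%E].

Definition is_affine (R : realType) (n : nat) (E : set 'rV[R]_n) : Prop :=
  forall (t : R) x y, E x -> E y -> E (t *: x + (1 - t) *: y).

(* The interior of C relative to its affine hull. *)
Definition rint (R : realType) (n : nat) (C : set 'rV[R]_n) : set 'rV[R]_n :=
  [set x | C x /\ \forall y \near x, smallest (@is_affine R n) C y -> C y].

Definition proper_fun (R : realType) (n : nat) (h : 'rV[R]_n -> \bar R) : Prop :=
  (forall x, (-oo < h x)%E) /\ dom h !=set0.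

(* closed = closed epigraph *)
Definition closed_fun (R : realType) (n : nat) (h : 'rV[R]_n -> \bar R) : Prop :=
  closed [set z : 'rV[R]_n * R | (h z.1 <= z.2%:E)%E].

Definition strictly_convex_fun (R : realType) (n : nat)
    (h : 'rV[R]_n -> \bar R) : Prop :=
  forall x y (t : R), dom h x -> dom h y -> x != y -> 0 < t < 1 ->
    (h (t *: x + (1 - t) *: y)%R < t%:E * h x + (1 - t)%:E * h y)%E.

Definition essentially_smooth (R : realType) (n : nat)
    (h : 'rV[R]_n -> \bar R) : Prop :=
  [/\ interior (dom h) !=set0,
      forall x, interior (dom h) x -> differentiable (fine \o h) x &
      forall (u : nat -> 'rV[R]_n) (x : 'rV[R]_n),
        (forall i, interior (dom h) (u i)) ->
        u @ \oo --> x -> (closure (dom h) `\` interior (dom h)) x ->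
        (fun i => `|grad (fine \o h) (u i)|) @ \oo --> +oo].

(* The identification of functions on A with vectors of R^|A|. *)
Definition vec (R : realType) (A : finType) (p : A -> R) : 'rV[R]_#|A| :=
  \row_i p (enum_val i).

Definition mirror_map (R : realType) (A : finType)
    (h : 'rV[R]_#|A| -> \bar R) : Prop :=
  [/\ [/\ proper_fun h, closed_fun h, strictly_convex_fun h
        & essentially_smooth h],
      forall p : A -> R, is_dist p -> dom h (vec p) &
      exists p : A -> R, is_dist p /\ rint (dom h) (vec p)].

Definition bregman (R : realType) (A : finType) (h : 'rV[R]_#|A| -> \bar R)
    (p q : A -> R) : R :=
  fine (h (vec p)) - fine (h (vec q))
  - dot (grad (fine \o h) (vec q)) (vec p - vec q).

Definition argmax_dist (R : realType) (A : finType) (f : (A -> R) -> R) :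
    set (A -> R) :=
  [set p | is_dist p /\ forall p', is_dist p' -> f p' <= f p].

(* <pi(.|s), Q(s,.)> = max_a Q(s,a) for all s *)
Definition greedy (R : realType) (S A : finType) (pi Q : S -> A -> R) : Prop :=
  forall s, \sum_a pi s a * Q s a = maxf (Q s).

(* The batches are consecutive pieces of a single trajectory: the k-th batch
   starts at global time batch_start B k, and s_t^k, a_t^k are the state and
   the action at global time batch_start B k + t.  This encodes
   s_0^(k+1) = s_(B_k)^k. *)
Definition batch_start (B : nat -> nat) (k : nat) : nat :=
  (\sum_(j < k) B j)%N.

(* The entry at (s, a) of the TD error produced by the transition
   (st, at_) -> st', for the critic Q and the policy pi. *)
Definition td_error (R : realType) (S A : finType) (M : mdp R S A)
    (pi Q : S -> A -> R) (st : S) (at_ : A) (st' : S) (s : S) (a : A) : R :=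
  ((st, at_) == (s, a))%:R
  * (reward M st at_ + discount M * (\sum_a' pi st' a' * Q st' a') - Q st at_).

(* A run of K + 1 rounds of Expected TD-PMD on the probability space
   (Omega, Pr).  The inputs are the behavior policy pib, the initial policy
   pi0, the critic step sizes alpha, the policy step sizes eta (functions of
   the round and of the current policy and critic), the initial state s0, the
   batch sizes B and the weights c k t = c_t^k; the outputs are the trajectory
   s, a and the iterates pi k w, Q k w. *)
Record expected_td_pmd (R : realType) (S A : finType) (M : mdp R S A)
    (h : 'rV[R]_#|A| -> \bar R) (K : nat) (pib pi0 : S -> A -> R)
    (alpha : nat -> R) (eta : nat -> (S -> A -> R) -> (S -> A -> R) -> R)
    (s0 : S) (B : nat -> nat) (c : nat -> nat -> R)
    (d : measure_display) (Omega : measurableType d) (Pr : probability Omega R)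
    (s : nat -> Omega -> S) (a : nat -> Omega -> A)
    (pi Q : nat -> Omega -> S -> A -> R) : Prop := ExpectedTDPMD {
  run_pib : is_policy pib ;
  run_pi0 : is_policy pi0 ;
  run_pi0_rint : forall x, rint (dom h) (vec (pi0 x)) ;
  run_batch : forall k, (k <= K)%N -> (0 < B k)%N ;
  run_weights : forall k, (k <= K)%N ->
    (forall t, (t < B k)%N -> 0 <= c k t) /\ \sum_(t < B k) c k t = 1 ;
  run_eta : forall k w, (k <= K)%N -> 0 < eta k (pi k w) (Q k w) ;
  run_pi_init : forall w, pi 0%N w = pi0 ;
  run_Q_init : forall w x b, Q 0%N w x b = 0 ;
  run_s_init : forall w, s 0%N w = s0 ;
  run_s_meas : forall n, (n <= batch_start B K.+1)%N -> is_random_elt (s n) ;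
  run_a_meas : forall n, (n < batch_start B K.+1)%N -> is_random_elt (a n) ;
  run_actor : forall k w x, (k <= K)%N ->
    argmax_dist (fun p : A -> R =>
                   eta k (pi k w) (Q k w) * (\sum_b p b * Q k w x b)
                   - bregman h p (pi k w x))
                (pi k.+1 w x) ;
  run_sample_action : forall n, (n < batch_start B K.+1)%N ->
    samples_action Pr pib s a n ;
  run_sample_state : forall n, (n < batch_start B K.+1)%N ->
    samples_state Pr M s a n ;
  run_critic : forall k w x b, (k <= K)%N ->
    Q k.+1 w x b = Q k w x b +
      alpha k * \sum_(t < B k)
        c k t * td_error M (pi k.+1 w) (Q k w)
                  (s (batch_start B k + t)%N w)
                  (a (batch_start B k + t)%N w)
                  (s (batch_start B k + t.+1)%N w) x b }.

Definition Xi (R : realType) (rho : R) (B : nat -> nat) (t : nat) : R :=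
  \sum_(k < t) rho ^+ (t - 1 - k)%N * (Num.sqrt (B k)%:R)^-1.

(* Main.v *)
(* Write Q^{k+1} = Q^k + alpha (Sigma (F_k Q^k - Q^k) + omega_k), where F_k is
   the Bellman operator of pi_{k+1} and Sigma = diag (nu (s) pi_b (a | s)).
   Comparing the maximiser pi_{k+1} of the mirror step with the greedy policy
   tpi_k gives F Q^k - gamma / eta <= F_k Q^k <= F Q^k for the optimal operator
   F, so |Q* - Q^{k+1}| <= rho |Q* - Q^k| + alpha gamma / eta + alpha |omega_k|,
   and |Q* - Q^{pi_K}| <= (2 gamma |Q* - Q^{K-1}| + gamma / eta) / (1 - gamma).
   Conditionally on the trajectory before batch k, omega_k is an average of
   bounded functions of a mixing chain whose stationary mean vanishes, whence
   E |omega_k| = O (B_k^{-1/2}).  That Q^pi is the fixed point of its Bellman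
   operator needs a process realising pi, which is coded into a single uniform
   variable; that the gradient of h is meaningful along the run needs the
   mirror steps to stay in the interior of dom h, by essential smoothness. *)

(* The obstacle is that a run constrains its iterates pointwise and supplies neither a filtration
   nor their measurability. Finiteness provides both. Up to a given time the trajectory takes
   finitely many values, and since the mirror step has a unique maximiser, the iterates used in
   batch k are functions of the trajectory before that batch. Every expectation is therefore an
   iterated finite sum [pathE], and conditioning on the past means splitting such a sum at the start
   of a batch ([pathE_cat]). The same calculus, applied to the state-action chain instead of the
   behavior chain, evaluates the expected return of a policy. The noise is estimated through its
   second moment: the squared max norm is at most the sum of the squared entries, which produces the
   factor |S||A|, and Jensen's inequality returns to the first moment. *)
From HB Require Import structures.
From mathcomp Require Import measurable_realfun ring lra.
Require Import Defs.
Set Implicit Arguments.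
Unset Strict Implicit.
Unset Printing Implicit Defensive.
Local Open Scope classical_set_scope.
Local Open Scope ring_scope.

(** * Finite Markov chains *)

Section FiniteFunctions.
Variables (R : realType) (T : finType).
Implicit Types (f p : T -> R).

Lemma range_has_sup f (z : T) : has_sup (range f).
Proof.
split; first by exists (f z), z.
exists (\sum_x `|f x|) => _ [x _ <-].
rewrite (le_trans (ler_norm _))// (bigD1 x)//= lerDl; exact: sumr_ge0.
Qed.

Lemma range_has_inf f (z : T) : has_inf (range f).
Proof.
split; first by exists (f z), z.
exists (- \sum_x `|f x|) => _ [x _ <-].
rewrite lerNl (le_trans (ler_norm _))// normrN (bigD1 x)//= lerDl.
exact: sumr_ge0.
Qed.

Lemma le_maxf f z : f z <= maxf f.
Proof. by apply: sup_upper_bound; [exact: range_has_sup | exists z]. Qed.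

Lemma minf_le f z : minf f <= f z.
Proof. by apply: ge_inf; [exact: (range_has_inf f z).2 | exists z]. Qed.

Lemma maxf_le f c (z : T) : (forall x, f x <= c) -> maxf f <= c.
Proof. by move=> fc; apply: ge_sup => [|_ [x _ <-]//]; exists (f z), z. Qed.

Lemma le_minf f c (z : T) : (forall x, c <= f x) -> c <= minf f.
Proof. by move=> fc; apply: lb_le_inf => [|_ [x _ <-]//]; exists (f z), z. Qed.

Lemma minf_attained f (z : T) : exists x, minf f = f x.
Proof.
have [x _ xmin] := @arg_minP _ _ _ z xpredT f isT.
exists x; apply/eqP; rewrite eq_le minf_le; apply: (le_minf z) => y.
exact: xmin.
Qed.

Lemma maxf_attained f (z : T) : exists x, maxf f = f x.
Proof.
have [x _ xmax] := @arg_maxP _ _ _ z xpredT f isT.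
exists x; apply/eqP; rewrite eq_le le_maxf andbT; apply: (maxf_le z) => y.
exact: xmax.
Qed.

Lemma dist_le1 p z : is_dist p -> p z <= 1.
Proof.
move=> [p0 p1]; rewrite -p1 (bigD1 z)//= lerDl; exact: sumr_ge0.
Qed.

Lemma dist_mean_le p f c : is_dist p -> (forall z, f z <= c) ->
  \sum_z p z * f z <= c.
Proof.
move=> [p0 p1] fc; rewrite -[leRHS]mul1r -p1 mulr_suml.
by apply: ler_sum => z _; exact: ler_wpM2l.
Qed.

Lemma dist_mean_ge p f c : is_dist p -> (forall z, c <= f z) ->
  c <= \sum_z p z * f z.
Proof.
move=> [p0 p1] fc; rewrite -[leLHS]mul1r -p1 mulr_suml.
by apply: ler_sum => z _; exact: ler_wpM2l.
Qed.

Lemma dist_mean_norm p f c : is_dist p -> (forall z, `|f z| <= c) ->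
  `|\sum_z p z * f z| <= c.
Proof.
move=> dp fc; rewrite ler_norml dist_mean_ge ?dist_mean_le// => z.
  by have:= fc z; rewrite ler_norml => /andP[].
by have:= fc z; rewrite ler_norml => /andP[].
Qed.

Lemma dist_mean_cst p c : is_dist p -> \sum_z p z * c = c.
Proof. by move=> [_ p1]; rewrite -mulr_suml p1 mul1r. Qed.

(* Evaluate the hypothesis at a maximiser of f. *)
Lemma contraction_bound f (g c : R) : 0 <= g < 1 ->
  (forall m, (forall z, f z <= m) -> forall z, f z <= g * m + c) ->
  forall z, f z <= c / (1 - g).
Proof.
move=> /andP[g0 g1] fP z; have [x xE] := maxf_attained f z.
have fx : forall y, f y <= f x by move=> y; rewrite -xE le_maxf.
apply: (le_trans (fx z)); rewrite ler_pdivlMr ?subr_gt0//.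
by have := fP _ fx x; lra.
Qed.

End FiniteFunctions.

(** * Expectations along finite paths of a chain, as iterated sums *)

Section Paths.
Variables (R : realType) (T : finType) (k : T -> T -> R).

(* Expectation of F (z_1, .., z_n) for the chain with kernel k, z_0 = z. *)
Fixpoint pathE n (z : T) (F : seq T -> R) : R :=
  if n is m.+1 then \sum_z' k z z' * pathE m z' (fun l => F (z' :: l))
  else F [::].

Definition kpow n (f : T -> R) (z : T) : R := pathE n z (fun l => f (last z l)).

Fixpoint pathsum (g : T -> T -> R) (z : T) (l : seq T) : R :=
  if l is z' :: l' then g z z' + pathsum g z' l' else 0.

Lemma eq_pathE n z F G : (forall l, size l = n -> F l = G l) ->
  pathE n z F = pathE n z G.
Proof.
elim: n z F G => [|n IH] z F G FG /=; first exact: FG.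
by apply: eq_bigr => z' _; congr (_ * _); apply: IH => l ln; apply: FG; rewrite /= ln.
Qed.

Lemma pathED n z F G :
  pathE n z (fun l => F l + G l) = pathE n z F + pathE n z G.
Proof.
elim: n z F G => [|n IH] z F G //=.
by rewrite -big_split/=; apply: eq_bigr => z' _; rewrite IH mulrDr.
Qed.

Lemma pathEZ n z c F : pathE n z (fun l => c * F l) = c * pathE n z F.
Proof.
elim: n z F => [|n IH] z F //=.
by rewrite mulr_sumr; apply: eq_bigr => z' _; rewrite IH mulrCA.
Qed.

Lemma pathE0 n z : pathE n z (fun=> 0) = 0.
Proof.
by elim: n z => //= n IH z; apply: big1 => z' _; rewrite IH mulr0.
Qed.

Lemma pathE_sum n z (I : Type) (r : seq I) (F : I -> seq T -> R) :
  pathE n z (fun l => \sum_(i <- r) F i l) = \sum_(i <- r) pathE n z (F i).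
Proof.
elim: r => [|i r IH].
  by rewrite big_nil -[RHS](pathE0 n z); apply: eq_pathE => l _; rewrite big_nil.
rewrite big_cons -IH -pathED; apply: eq_pathE => l _; exact: big_cons.
Qed.

Lemma pathE_cat m n z F :
  pathE (m + n) z F = pathE m z (fun l => pathE n (last z l) (fun l' => F (l ++ l'))).
Proof.
elim: m z F => [|m IH] z F //=.
by apply: eq_bigr => z' _; rewrite IH.
Qed.

Lemma pathE_rcons n z F :
  pathE n.+1 z F =
  pathE n z (fun l => \sum_z' k (last z l) z' * F (rcons l z')).
Proof.
rewrite -addn1 pathE_cat; apply: eq_pathE => l _ /=.
by apply: eq_bigr => z' _; rewrite cats1.
Qed.

Lemma kpowS n f z : kpow n.+1 f z = \sum_z' k z z' * kpow n f z'.
Proof. by []. Qed.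

Lemma kpowSr n f z : kpow n.+1 f z = kpow n (fun y => \sum_z' k y z' * f z') z.
Proof.
rewrite /kpow pathE_rcons; apply: eq_pathE => l _.
by apply: eq_bigr => z' _; rewrite last_rcons.
Qed.

Hypothesis k_dist : forall z, is_dist (k z).

Lemma pathE_cst n z c : pathE n z (fun=> c) = c.
Proof.
elim: n z => [|n IH] z //=.
by under eq_bigr do rewrite IH; exact: dist_mean_cst.
Qed.

Lemma pathE_pathsum n z g :
  pathE n z (pathsum g z) =
  \sum_(t < n) kpow t (fun y => \sum_z' k y z' * g y z') z.
Proof.
elim: n z => [|n IH] z; first by rewrite big_ord0.
rewrite big_ord_recl /=; under eq_bigr => z' _.
  rewrite (@eq_pathE _ _ _ (fun l => g z z' * 1 + pathsum g z' l)); last first.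
    by move=> l _; rewrite mulr1.
  rewrite pathED pathEZ pathE_cst IH mulrDr mulr1; over.
rewrite big_split/=; congr (_ + _).
under eq_bigr do rewrite mulr_sumr.
by rewrite exchange_big.
Qed.

Lemma le_pathE n z F G : (forall l, size l = n -> F l <= G l) ->
  pathE n z F <= pathE n z G.
Proof.
elim: n z F G => [|n IH] z F G FG /=; first exact: FG.
apply: ler_sum => z' _; apply: ler_wpM2l; first exact: (k_dist z).1.
by apply: IH => l ln; apply: FG; rewrite /= ln.
Qed.

Lemma pathE_le n z F c : (forall l, size l = n -> F l <= c) -> pathE n z F <= c.
Proof. by move=> Fc; rewrite -[leRHS](pathE_cst n z); exact: le_pathE. Qed.

(** Jensen's inequality for the square, read off from the nonnegativity of the variance. *)
Lemma pathE_sqr_le n z F : pathE n z F ^+ 2 <= pathE n z (fun l => F l ^+ 2).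
Proof.
have : 0 <= pathE n z (fun l => (F l - pathE n z F) ^+ 2).
  rewrite -[leLHS](pathE_cst n z); apply: le_pathE => l _; exact: sqr_ge0.
set c := pathE n z F.
rewrite (@eq_pathE _ _ _ (fun l => F l ^+ 2 + ((- (2 * c)) * F l + c ^+ 2))); last first.
  by move=> l _; ring.
by rewrite pathED pathED pathEZ pathE_cst -/c; lra.
Qed.

(* The square of the sum splits as g_0^2 + 2 g_0 S + S^2, where S is the sum over
   the later steps, whose conditional mean is a geometric series. *)
Lemma pathE_pathsum_sqr g (c d q : R) n z :
  0 <= q < 1 -> 0 <= d -> (forall y y', `|g y y'| <= c) ->
  (forall t y, `|kpow t (fun y => \sum_z' k y z' * g y z') y| <= d * q ^+ t) ->
  pathE n z (fun l => pathsum g z l ^+ 2) <= n%:R * (c ^+ 2 + 2 * c * d / (1 - q)).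
Proof.
move=> /andP[q0 q1] d0 gc gd.
have mean m y : `|pathE m y (pathsum g y)| <= d / (1 - q).
  rewrite pathE_pathsum (le_trans (ler_norm_sum _ _ _))//.
  apply: (@le_trans _ _ (\sum_(t < m) d * q ^+ t)); first by apply: ler_sum.
  rewrite -mulr_sumr; apply: ler_wpM2l => //.
  rewrite -div1r ler_pdivlMr ?subr_gt0//.
  have := subrX1 q m; have := exprn_ge0 m q0; lra.
elim: n z => [|n IH] z /=; first by rewrite expr0n mul0r.
apply: dist_mean_le => // z'.
rewrite (@eq_pathE _ _ _ (fun l => g z z' ^+ 2 + ((2 * g z z') * pathsum g z' l
   + pathsum g z' l ^+ 2))); last by move=> l _; ring.
rewrite pathED pathED pathE_cst pathEZ -(natr1 n) [leRHS]mulrDl mul1r.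
have c0 : 0 <= c := le_trans (normr_ge0 _) (gc z z).
have gg : g z z' ^+ 2 <= c ^+ 2 by rewrite -real_normK ?num_real// lerXn2r ?nnegrE.
have gm : 2 * g z z' * pathE n z' (pathsum g z') <= 2 * c * d / (1 - q).
  rewrite -!mulrA ler_pM2l// (le_trans (ler_norm _))// normrM.
  by apply: ler_pM.
by have := IH z'; lra.
Qed.

End Paths.

(** * Processes with a prescribed chain law *)

Section Trajectories.
Variables (R : realType) (T : finType).
Variables (d : measure_display) (Omega : measurableType d)
  (Pr : probability Omega R).

Lemma expectation_finite (I : finType) (X : Omega -> I) (f : I -> R) :
  is_random_elt X ->
  ('E_Pr[fun w => f (X w)] =
   (\sum_x f x * fine (Pr [set w | X w = x]))%:E)%E.
Proof.
move=> mX; rewrite unlock.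
transitivity (\int[Pr]_w (\sum_x (f x)%:E * (\1_[set w | X w = x] w)%:E))%E.
  apply: eq_integral => w _; rewrite (bigD1 (X w))//= big1 => [|x xX].
    by rewrite indicE mem_set// mule1 adde0.
  by rewrite indicE memNset ?mule0//= => XE; rewrite XE eqxx in xX.
have intI x : Pr.-integrable setT (fun w => (\1_[set w | X w = x] w)%:E).
  exact: integrable_indic.
rewrite integral_sum//; last by move=> x; exact: integrableZl.
rewrite -sumEFin; apply: eq_bigr => x _.
rewrite integralZl//= integral_indic//= setIT EFinM fineK//.
exact: fin_num_measure.
Qed.

Variables (k : T -> T -> R) (Z : nat -> Omega -> T) (z0 : T).

Definition traj n w := mkseq (fun i => Z i w) n.

Lemma size_traj n w : size (traj n w) = n. Proof. exact: size_mkseq. Qed.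

(** The Markov property in product form, so that null trajectories need no convention. [traj] omits
    the starting point [z0], and the horizon is finite because a run prescribes its law only up to
    the end of the last batch. *)
Definition chain_law N := forall n l z, (n < N)%N -> size l = n ->
  measurable [set w | traj n.+1 w = rcons l z] /\
  (Pr [set w | traj n.+1 w = rcons l z] =
   Pr [set w | traj n w = l] * (k (last z0 l) z)%:E)%E.

Lemma traj_measurable N n l : chain_law N -> (n <= N)%N ->
  measurable [set w | traj n w = l].
Proof.
move=> law nN; have [sl|nsl] := eqVneq (size l) n; last first.
  rewrite (_ : [set _ | _] = set0)//; apply/seteqP; split => // w /= lE.
  by rewrite -lE size_traj eqxx in nsl.
case: n nN sl => [_|n nN].
  by case: l => // _; rewrite (_ : [set _ | _] = setT)//; apply/seteqP; split.
case/lastP: l => // l z; rewrite size_rcons => -[sl].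
by have [] := law n l z nN sl.
Qed.

Lemma sum_traj_pathE N n (F : seq T -> R) : chain_law N -> (n <= N)%N ->
  \sum_(t : n.-tuple T) F t * fine (Pr [set w | traj n w = t]) = pathE k n z0 F.
Proof.
move=> law; elim: n F => [|n IH] F nN.
  rewrite (big_pred1 [tuple]) => [|t]; last by apply/esym/eqP; rewrite [t]tuple0; exact: val_inj.
  rewrite (_ : [set _ | _] = setT) ?probability_setT ?mulr1//.
  by apply/seteqP; split.
rewrite pathE_rcons -IH ?(ltnW nN)//.
under [RHS]eq_bigr do rewrite mulr_suml.
(* Splitting off the last state is a bijection of tuples; injectivity and a count of both sides
   suffice. *)
pose rc (p : n.-tuple T * T) := [tuple of rcons p.1 p.2].
rewrite pair_big/= (reindex rc)/=.
  apply: eq_bigr => -[t z] _ /=.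
  have [_ ->] := law n t z nN (size_tuple t).
  rewrite fineM//; last exact: fin_num_measure (traj_measurable _ law (ltnW nN)).
  rewrite /=; ring.
apply: onW_bij; apply: inj_card_bij => [[t z] [t' z'] /(congr1 val)/= /rcons_inj[/val_inj -> ->]//|].
by rewrite card_prod !card_tuple expnS mulnC.
Qed.

(** The bridge from integrals over the probability space to finite sums. Nothing is asked of [F],
    since a trajectory of fixed length is a finite-valued random element. *)
Lemma expectation_traj N n (F : seq T -> R) : chain_law N -> (n <= N)%N ->
  ('E_Pr[fun w => F (traj n w)] = (pathE k n z0 F)%:E)%E.
Proof.
move=> law nN; rewrite -(sum_traj_pathE F law nN).
have := @expectation_finite (n.-tuple T) (fun w => [tuple of mkseq (fun i => Z i w) n])
  (fun t => F t).
rewrite /=  => -> /=.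
  congr EFin; apply: eq_bigr => t _; congr (_ * fine (Pr _)).
  by apply/seteqP; split => w /= => [<-//|wt]; exact: val_inj.
move=> t; rewrite (_ : [set _ | _] = [set w | traj n w = t]).
  exact: traj_measurable law nN.
by apply/seteqP; split => w /= => [<-//|wt]; exact: val_inj.
Qed.

End Trajectories.

(** * Realising a finite chain by a single uniform variable *)

Section Quantile.
Variables (R : realType) (T : finType).
Implicit Types (p : T -> R) (v : R).

Definition cum p i : R := \sum_(y <- take i (enum T)) p y.

Definition lower p (j : T) : R := cum p (index j (enum T)).

Lemma cum_homo p : is_dist p -> {homo cum p : i j / (i <= j)%N >-> i <= j}.
Proof.
move=> [p0 _]; apply: homo_leq => [//||i]; first exact: le_trans.
rewrite /cum; have [iT|Ti] := ltnP i (size (enum T)); last first.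
  by rewrite !take_oversize// (leq_trans Ti).
have /card_gt0P[y _] : (0 < #|T|)%N by rewrite cardE (leq_trans _ iT).
by rewrite (take_nth y)// -cats1 big_cat big_seq1 /= lerDl.
Qed.

Lemma cumS p j : cum p (index j (enum T)).+1 = lower p j + p j.
Proof.
rewrite /lower /cum (take_nth j) ?index_mem ?mem_enum//.
by rewrite -cats1 big_cat big_seq1 nth_index ?mem_enum.
Qed.

Lemma lower_ge0 p j : is_dist p -> 0 <= lower p j.
Proof. by move=> [p0 _]; exact: sumr_ge0. Qed.

Lemma lowerD_le1 p j : is_dist p -> lower p j + p j <= 1.
Proof.
move=> dp; rewrite -cumS -(proj2 dp).
rewrite (@le_trans _ _ (cum p #|T|))//.
  by apply: cum_homo => //; rewrite cardE index_mem mem_enum.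
by rewrite /cum cardE take_size big_enum.
Qed.

Lemma lower_exists p v : is_dist p -> 0 <= v < 1 ->
  exists j, lower p j <= v < lower p j + p j.
Proof.
move=> dp /andP[v0 v1].
have exi : exists i, v < cum p i.
  by exists #|T|; rewrite /cum cardE take_size big_enum (proj2 dp).
case: (ex_minnP exi) => -[|i] vi imin.
  by move: vi; rewrite /cum take0 big_nil ltNge v0.
have civ : cum p i <= v.
  by rewrite leNgt; apply/negP => /imin; rewrite ltnn.
have iT : (i < size (enum T))%N.
  rewrite ltnNge; apply/negP => Ti; have := lt_le_trans vi (_ : _ <= cum p i).
  by rewrite /cum !take_oversize ?(leq_trans Ti)// => /(_ (lexx _)); rewrite ltNge -{1}(take_oversize Ti) civ.
have /card_gt0P[y _] : (0 < #|T|)%N by rewrite cardE (leq_trans _ iT).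
exists (nth y (enum T) i).
by rewrite -cumS /lower index_uniq ?enum_uniq// civ.
Qed.

Lemma lower_unique p v j j' : is_dist p -> lower p j <= v < lower p j + p j ->
  lower p j' <= v < lower p j' + p j' -> j = j'.
Proof.
move=> dp; wlog : j j' / (index j (enum T) < index j' (enum T))%N.
  move=> H jv j'v.
  have [lt_jj'|lt_j'j|] := ltngtP (index j (enum T)) (index j' (enum T)).
  - exact: H jv j'v.
  - by apply/esym; exact: H j'v jv.
  by move=> /(congr1 (nth j (enum T))); rewrite !nth_index ?mem_enum.
rewrite -!cumS => /(cum_homo dp) jj' /andP[_ vj] /andP[j'v _].
by have := lt_le_trans vj (le_trans jj' j'v); rewrite ltxx.
Qed.

(** For a distribution [p] the half-open cells tile [0, 1[, a point of mass zero owning an empty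
    one, so the fallback [z] is reached only for [v] outside [0, 1[. *)
Definition quantile p v (z : T) : T :=
  odflt z [pick j | lower p j <= v < lower p j + p j].

Lemma quantileE p v z j : is_dist p -> 0 <= v < 1 ->
  (quantile p v z == j) = (lower p j <= v < lower p j + p j).
Proof.
move=> dp v01; rewrite /quantile; case: pickP => [i iv|no] /=; last first.
  by have [i] := lower_exists dp v01; rewrite no.
by apply/eqP/idP => [<-//|]; exact: lower_unique.
Qed.

End Quantile.

(** The uniform law on [0, 1[, carried by the whole line. The coding must therefore be total, which
    is why [code] replaces a point outside [0, 1[ by 0. *)
Definition unit_prob (R : realType) : set (measurableTypeR R) -> \bar R :=
  mrestr lebesgue_measure (measurable_itv `[0:R, 1[).

HB.instance Definition _ (R : realType) := Measure.on (@unit_prob R).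

Lemma unit_probT (R : realType) : @unit_prob R setT = 1%E.
Proof.
by rewrite /unit_prob /mrestr setTI lebesgue_measure_itv/= lte_fin ltr01 oppr0 adde0.
Qed.

HB.instance Definition _ (R : realType) :=
  Measure_isProbability.Build _ _ R (@unit_prob R) (@unit_probT R).

Section Coding.
Variables (R : realType) (T : finType) (k : T -> T -> R) (z0 : T).
Hypothesis k_dist : forall z, is_dist (k z).

(* The chain is read off a single uniform variable w: given the state z and a
   residual v uniform on [0, 1[, the next state is the quantile of k z at v,
   and the new residual is the relative position of v in the selected cell. *)
Definition code_step (zv : T * R) : T * R :=
  let z := quantile (k zv.1) zv.2 zv.1 in
  (z, (zv.2 - lower (k zv.1) z) / k zv.1 z).

Definition code (n : nat) (w : R) : T * R :=
  iter n code_step (z0, if 0 <= w < 1 then w else 0).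

Definition coded_chain (n : nat) (w : measurableTypeR R) : T := (code n.+1 w).1.

Lemma code_state n w : (code n w).1 = last z0 (traj coded_chain n w).
Proof. by case: n => [|n]//; rewrite /traj mkseqS last_rcons. Qed.

Lemma code_step_residual z v : 0 <= v < 1 ->
  0 <= (code_step (z, v)).2 < 1.
Proof.
move=> v01; rewrite /code_step /=.
set z' := quantile _ _ _.
have : quantile (k z) v z == z' by [].
rewrite quantileE// => /andP[lv vl].
have kz : 0 < k z z' by lra.
rewrite divr_ge0 ?subr_ge0// ?ltW//=.
by rewrite ltr_pdivrMr// mul1r; lra.
Qed.

Lemma code_residual n w : 0 <= (code n w).2 < 1.
Proof.
elim: n => [|n IH]; first by rewrite /=; case: ifP => // _; rewrite lexx ltr01.
rewrite /code iterS -/(code n w); case: (code n w) IH => z v; exact: code_step_residual.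
Qed.

(** Within [0, 1[ the cylinder of [l] is the interval [c, c + p[, and the residual is the affine
    coordinate of [w] in it. The second clause carries the induction: the next symbol cuts this
    interval in the proportions of the kernel, so lengths multiply as probabilities do. *)
Definition is_cell (l : seq T) (c p : R) :=
  [/\ 0 <= c, 0 <= p, c + p <= 1 &
      forall w, 0 <= w < 1 ->
        (traj coded_chain (size l) w == l) = (c <= w < c + p) /\
        (c <= w < c + p -> w = c + p * (code (size l) w).2)].

Lemma is_cell_nil : is_cell [::] 0 1.
Proof.
split; rewrite ?add0r// => w w01; split; first by rewrite w01.
by rewrite /= w01 add0r mul1r.
Qed.

Lemma is_cell_rcons l z c p : is_cell l c p ->
  is_cell (rcons l z) (c + p * lower (k (last z0 l)) z) (p * k (last z0 l) z).
Proof.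
move=> [c0 p0 cp cell]; set y := last z0 l.
have lo0 := lower_ge0 z (k_dist y); have lo1 := lowerD_le1 z (k_dist y).
have k0 : 0 <= k y z := (k_dist y).1 z.
split => [|||w w01].
- by rewrite addr_ge0// mulr_ge0.
- exact: mulr_ge0.
- by rewrite -addrA -mulrDr (le_trans _ cp)// lerD2l ler_piMr.
have [cE wE] := cell w w01.
rewrite size_rcons /traj mkseqS eqseq_rcons -/(traj _ _ w) cE.
have [cw|ncw] := boolP (c <= w < c + p); last first.
  suff -> : (c + p * lower (k y) z <= w < c + p * lower (k y) z + p * k y z) = false by [].
  apply/negbTE; apply: contra ncw => /andP[h1 h2].
  have := mulr_ge0 p0 lo0; have := ler_piMr p0 lo1; rewrite mulrDr => ? ?.
  by apply/andP; split; lra.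
have {wE} := wE cw; have := code_residual (size l) w.
have wl : traj coded_chain (size l) w = l by apply/eqP; rewrite cE.
have := code_state (size l) w; rewrite wl -/y.
rewrite /coded_chain /code !iterS -/(code _ w).
case: (code _ _) => y' v /= -> v01 wE.
have pp : 0 < p by move/andP: cw => [? ?]; lra.
rewrite quantileE//.
have -> : (c + p * lower (k y) z <= w < c + p * lower (k y) z + p * k y z) =
    (lower (k y) z <= v < lower (k y) z + k y z).
  by rewrite wE -addrA -mulrDr lerD2l ltrD2l ler_pM2l// ltr_pM2l.
split=> // vz; have /eqP-> : quantile (k y) v y == z by rewrite quantileE.
have kz : k y z != 0 by apply: lt0r_neq0; move/andP: vz => [? ?]; lra.
by rewrite wE; field.
Qed.

Lemma is_cell_exists l : exists c p, is_cell l c p.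
Proof.
elim/last_ind: l => [|l z [c [p cp]]]; first by exists 0, 1; exact: is_cell_nil.
by eexists; eexists; exact: is_cell_rcons cp.
Qed.

Lemma cell_measurable l c p : is_cell l c p ->
  measurable [set w | traj coded_chain (size l) w = l].
Proof.
move=> [c0 p0 cp cell].
(* All points outside [0, 1[ share the trajectory of the point 1, so they belong to the cylinder
   together or not at all. *)
pose J := if traj coded_chain (size l) 1 == l then ~` `[0:R, 1[%classic else set0.
rewrite (_ : [set _ | _] = `[c, (c + p)%R[%classic `|` J).
  apply: measurableU => //; rewrite /J; case: ifP => // _; exact: measurableC.
have out w : ~~ (0 <= w < 1) -> traj coded_chain (size l) w = traj coded_chain (size l) 1.
  move=> nw; apply: eq_map => i; rewrite /coded_chain /code (negbTE nw).
  by rewrite ltxx andbF.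
apply/seteqP; split => w /=; rewrite in_itv/=.
  have [w01|nw] := boolP (0 <= w < 1).
    by have [<- _] := cell w w01 => /eqP ->; left.
  by rewrite out// => wl; right; rewrite /J wl eqxx /= in_itv/=; exact/negP.
case=> [cw|].
  apply/eqP; have w01 : 0 <= w < 1 by move/andP: cw => [? ?]; apply/andP; split; lra.
  by have [-> _] := cell w w01.
rewrite /J; case: ifP => // /eqP JE /=; rewrite in_itv/= => /negP nw.
by rewrite out.
Qed.

Lemma cell_prob l c p : is_cell l c p ->
  @unit_prob R [set w | traj coded_chain (size l) w = l] = p%:E.
Proof.
move=> [c0 p0 cp cell]; rewrite /unit_prob /mrestr.
rewrite (_ : _ `&` _ = `[c, (c + p)%R[%classic).
  rewrite lebesgue_measure_itv/= lte_fin ltrDl -EFinB addrAC subrr add0r.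
  by case: ltrgtP p0 => // <-.
apply/seteqP; split => w /=; rewrite !in_itv/=.
  by move=> [/eqP wl w01]; have [<- _] := cell w w01.
move=> cw; have w01 : 0 <= w < 1 by move/andP: cw => [? ?]; apply/andP; split; lra.
by split => //; apply/eqP; have [-> _] := cell w w01.
Qed.

Lemma coded_chain_law N : chain_law (@unit_prob R) k coded_chain z0 N.
Proof.
move=> n l z _ <-; have [c [p cp]] := is_cell_exists l.
have cpz := is_cell_rcons z cp.
rewrite -[(size l).+1](size_rcons l z); split; first exact: cell_measurable cpz.
by have := cell_prob cpz; rewrite EFinM -(cell_prob cp).
Qed.

End Coding.

(** * Action values *)

Lemma mkseq_eqP (T : Type) (f g : nat -> T) n :
  mkseq f n = mkseq g n <-> forall i, (i < n)%N -> f i = g i.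
Proof.
elim: n => [|n IH]; first by split.
rewrite !mkseqS; split => [/rcons_inj[/IH fg fgn] i|fg].
  by rewrite ltnS leq_eqVlt => /orP[/eqP->//|]; exact: fg.
by congr rcons; [apply/IH => i ?; apply: fg; exact: ltnW|exact: fg].
Qed.

(** * The state-action chain of a policy and its equivalence with the process *)

Section PolicyChain.
Variables (R : realType) (S A : finType) (M : mdp R S A) (pi : S -> A -> R).

Definition policy_kernel (z z' : S * A) : R :=
  transition M z.1 z.2 z'.1 * pi z'.1 z'.2.

Lemma sum_policy_kernel z (f : S -> A -> R) :
  \sum_z' policy_kernel z z' * f z'.1 z'.2 =
  \sum_s' transition M z.1 z.2 s' * (\sum_a' pi s' a' * f s' a').
Proof.
under [RHS]eq_bigr do rewrite mulr_sumr.
by rewrite pair_big/=; apply: eq_bigr => -[s a] _; rewrite /= mulrA.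
Qed.

Hypothesis pi_policy : is_policy pi.

Lemma policy_kernel_dist z : is_dist (policy_kernel z).
Proof.
split=> [z'|].
  by apply: mulr_ge0; [exact: (transition_dist M _ _).1|exact: (pi_policy _).1].
transitivity (\sum_z' policy_kernel z z' * 1); first by under [RHS]eq_bigr do rewrite mulr1.
rewrite (@sum_policy_kernel z (fun _ _ => 1)).
under eq_bigr do (under eq_bigr do rewrite mulr1; rewrite (pi_policy _).2 mulr1).
exact: (transition_dist M _ _).2.
Qed.

Section Law.
Variables (d : measure_display) (Omega : measurableType d)
  (Pr : probability Omega R) (s : nat -> Omega -> S) (a : nat -> Omega -> A)
  (z0 : S * A).
Hypothesis start : forall w, s 0%N w = z0.1 /\ a 0%N w = z0.2.

Let Z n w := (s n.+1 w, a n.+1 w).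

Lemma last_policy_traj n w : last z0 (traj Z n w) = (s n w, a n w).
Proof.
case: n => [|n]; last by rewrite /traj mkseqS last_rcons.
by have [-> ->] := start w; case: z0.
Qed.

Lemma history_action_traj n x y : x 0%N = z0.1 -> y 0%N = z0.2 ->
  history s a n x y `&` [set w | a n w = y n] =
  [set w | traj Z n w = mkseq (fun i => (x i.+1, y i.+1)) n].
Proof.
move=> x0 y0; apply/seteqP; split => w /=.
  move=> [[sx ay] an]; apply/mkseq_eqP => i ni; rewrite /Z sx//.
  by move: ni; rewrite leq_eqVlt => /orP[/eqP ->|/ay ->//]; rewrite an.
move/mkseq_eqP => ZE.
have sE i : (i <= n)%N -> s i w = x i /\ a i w = y i.
  case: i => [_|i ni]; first by rewrite x0 y0.
  by have [-> ->] := ZE i ni.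
split; last exact: (sE n (leqnn n)).2.
by split=> i ni; [exact: (sE i ni).1|exact: (sE i (ltnW ni)).2].
Qed.

Lemma policy_process_law N :
  policy_process M pi z0.1 z0.2 Pr s a -> chain_law Pr policy_kernel Z z0 N.
Proof.
move=> [meas _ hs ha] n l z _ sl; split.
  pose F i := [set w | s i.+1 w = (nth z0 (rcons l z) i).1] `&`
    [set w | a i.+1 w = (nth z0 (rcons l z) i).2].
  suff -> : [set w | traj Z n.+1 w = rcons l z] = \bigcap_(i in `I_n.+1) F i.
    apply: fin_bigcap_measurable => [|i _]; first exact: finite_II.
    by apply: measurableI; have [ms ma] := meas i.+1; [exact: ms|exact: ma].
  rewrite -{1}[rcons l z](mkseq_nth z0) size_rcons sl.
  apply/seteqP; split => w /=.
    by move/mkseq_eqP => ZE i /= ni; split; rewrite /= -ZE.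
  move=> wZ; apply/mkseq_eqP => i ni; have [sE aE] := wZ i ni.
  by rewrite /Z [s i.+1 w]sE [a i.+1 w]aE -surjective_pairing.
pose x i := (nth z0 (z0 :: rcons l z) i).1; pose y i := (nth z0 (z0 :: rcons l z) i).2.
have lE : mkseq (fun i => (x i.+1, y i.+1)) n = l.
  apply: (@eq_from_nth _ z0) => [|i]; rewrite size_mkseq// => ni.
  by rewrite nth_mkseq// /x /y /= nth_rcons sl ni -surjective_pairing.
have lzE : mkseq (fun i => (x i.+1, y i.+1)) n.+1 = rcons l z.
  by rewrite mkseqS lE /x /y /= nth_rcons sl ltnn eqxx -surjective_pairing.
rewrite -lzE -(history_action_traj n.+1 (erefl : x 0%N = z0.1) (erefl : y 0%N = z0.2)).
rewrite ha hs (history_action_traj n (erefl : x 0%N = z0.1) (erefl : y 0%N = z0.2)) lE.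
have nthn : nth z0 (z0 :: rcons l z) n = last z0 l.
  by rewrite -rcons_cons nth_rcons /= sl ltnSn (last_nth z0) sl.
have nthS : nth z0 (z0 :: rcons l z) n.+1 = z by rewrite /= nth_rcons sl ltnn eqxx.
by rewrite -muleA -EFinM /x /y nthn nthS.
Qed.

Lemma chain_law_policy_process :
  (forall n, is_random_elt (s n) /\ is_random_elt (a n)) ->
  (forall N, chain_law Pr policy_kernel Z z0 N) ->
  policy_process M pi z0.1 z0.2 Pr s a.
Proof.
move=> meas law.
have hs n : samples_state Pr M s a n.
  move=> x y.
  (* A history with another starting point is impossible, and both sides vanish. *)
  have [[x0 y0]|nxy] := pselect (x 0%N = z0.1 /\ y 0%N = z0.2); last first.
    have start0 w : history s a n x y w -> a n w = y n -> x 0%N = z0.1 /\ y 0%N = z0.2.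
      move=> [sx ay] an; have [<- <-] := start w; split; first by rewrite sx.
      by case: n ay an {sx} => [|n] ay an; [rewrite an|rewrite ay].
    have -> : history s a n.+1 x y = set0.
      apply/seteqP; split => // w [sx ay]; apply/nxy/(start0 w); last exact: ay.
      by split=> i ni; [exact/sx/ltnW|exact/ay/ltnW].
    have -> : history s a n x y `&` [set w | a n w = y n] = set0.
      by apply/seteqP; split => // w [/= h /(start0 w h)].
    by rewrite measure0 mul0e.
  rewrite history_action_traj//; set l := mkseq _ n.
  have -> : history s a n.+1 x y =
      \bigcup_(b in [set: A]) [set w | traj Z n.+1 w = rcons l (x n.+1, b)].
    (* The history fixes the next state but not the next action, so it is a disjoint union over the
       next action [b]; the policy weights of the pieces then sum to 1. *)
    pose y' b i := if (i < n.+1)%N then y i else b.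
    have mk b : mkseq (fun i => (x i.+1, y' b i.+1)) n.+1 = rcons l (x n.+1, b).
      rewrite mkseqS /y' ltnn; congr rcons.
      by apply/mkseq_eqP => i ni; rewrite ltnS ni.
    apply/seteqP; split => w /=.
      move=> [sx ay]; exists (a n.+1 w) => //.
      have : (history s a n.+1 x (y' (a n.+1 w)) `&` [set w' | a n.+1 w' = y' (a n.+1 w) n.+1]) w.
        split; last by rewrite /= /y' ltnn.
        by split=> i ni; [exact: sx|rewrite /y' ni; exact: ay].
      by rewrite history_action_traj// /mkset mk.
    move=> [b _]; rewrite -mk => wE.
    have : [set w | traj Z n.+1 w = mkseq (fun i => (x i.+1, y' b i.+1)) n.+1] w by [].
    rewrite -history_action_traj// => -[[sx ay] _]; split=> // i ni.
    by rewrite ay// /y' ni.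
  rewrite measure_fin_bigcup//=; last 2 first.
  - by move=> b b' _ _ [w [/= ->]] /rcons_inj[].
  - by move=> b _; exact: traj_measurable (law n.+1) (leqnn _).
  rewrite (fsbigE (index_enum A))//=; last 2 first.
  - exact: index_enum_uniq.
  - by move=> b _ /negP[]; exact: mem_index_enum.
  under eq_bigl do rewrite in_setT.
  under eq_bigr => b _ do rewrite (law n.+1 n l _ (ltnSn _) (size_mkseq _ _)).2.
  have lE : last z0 l = (x n, y n).
    rewrite /l; case: (n) => [|m]; last by rewrite mkseqS last_rcons.
    by rewrite /= x0 y0 -surjective_pairing.
  have : Pr [set w | traj Z n w = l] \is a fin_num by exact: fin_num_measure (traj_measurable _ (law n) _).
  move/fineK => <-; under eq_bigr do rewrite -EFinM.
  rewrite sumEFin -EFinM; congr EFin.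
  rewrite lE -mulr_sumr /policy_kernel/=; congr (_ * _).
  by rewrite -mulr_sumr (pi_policy _).2 mulr1.
split=> // n x y.
have [[x0 y0]|nxy] := pselect (x 0%N = z0.1 /\ y 0%N = z0.2); last first.
  have -> : history s a n.+1 x y = set0; last by rewrite set0I measure0 mul0e.
  apply/seteqP; split => // w [sx ay]; apply: nxy.
  by have [<- <-] := start w; rewrite sx// ay.
rewrite hs !history_action_traj// mkseqS.
have [_ ->] := law n.+1 n (mkseq (fun i => (x i.+1, y i.+1)) n) (x n.+1, y n.+1) (ltnSn _) (size_mkseq _ _).
rewrite -muleA -EFinM /policy_kernel /=.
suff -> : last z0 (mkseq (fun i => (x i.+1, y i.+1)) n) = (x n, y n) by [].
by case: n => [|n]; [rewrite /= x0 y0 -surjective_pairing|rewrite mkseqS last_rcons].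
Qed.

End Law.
End PolicyChain.

Section Existence.
Variables (R : realType) (S A : finType) (M : mdp R S A) (pi : S -> A -> R).
Hypothesis pi_policy : is_policy pi.
Variable z0 : S * A.

Let k := policy_kernel M pi.
Let kd := policy_kernel_dist M pi_policy.

Definition coded_state n (w : measurableTypeR R) : S * A :=
  if n is m.+1 then coded_chain k z0 m w else z0.

Let s n w := (coded_state n w).1.
Let a n w := (coded_state n w).2.

Lemma coded_state_measurable n : is_random_elt (coded_state n).
Proof.
move=> z; case: n => [|n] /=.
  have [->|nz] := eqVneq z0 z; first by rewrite (_ : [set _ | _] = setT)//; apply/seteqP.
  by rewrite (_ : [set _ | _] = set0)//; apply/seteqP; split => // w /= zE; rewrite zE eqxx in nz.
rewrite (_ : [set _ | _] = \bigcup_(t in [set t : n.+1.-tuple (S * A) | last z0 t = z])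
   [set w | traj (coded_chain k z0) n.+1 w = t]).
  apply: fin_bigcup_measurable => [|t _]; first exact: finite_finset.
  exact: traj_measurable (@coded_chain_law _ _ _ z0 kd n.+1) (leqnn _).
apply/seteqP; split => w /=.
  move=> <-; exists [tuple of mkseq (fun i => coded_chain k z0 i w) n.+1] => //.
  by rewrite /mkset [LHS](_ : _ = last z0 (mkseq (fun i => coded_chain k z0 i w) n.+1))// mkseqS last_rcons.
by move=> [t /= <- <-]; rewrite /traj mkseqS last_rcons.
Qed.

Lemma coded_policy_process :
  policy_process M pi z0.1 z0.2 (@unit_prob R) s a.
Proof.
apply: chain_law_policy_process => // [n|N].
  split=> [x|y].
    rewrite (_ : [set _ | _] = \bigcup_(y in [set: A]) [set w | coded_state n w = (x, y)]).
      by apply: fin_bigcup_measurable => [|y _]; [exact: finite_finset|exact: coded_state_measurable].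
    apply/seteqP; split => w /= => [<-|[y _]].
      by exists (a n w) => //; rewrite /s /a /= -surjective_pairing.
    by rewrite /s => ->.
  rewrite (_ : [set _ | _] = \bigcup_(x in [set: S]) [set w | coded_state n w = (x, y)]).
    by apply: fin_bigcup_measurable => [|x _]; [exact: finite_finset|exact: coded_state_measurable].
  apply/seteqP; split => w /= => [<-|[x _]].
    by exists (s n w) => //; rewrite /s /a /= -surjective_pairing.
  by rewrite /a => ->.
have -> : (fun n w => (s n.+1 w, a n.+1 w)) = coded_chain k z0.
  by apply/funext => n; apply/funext => w; rewrite /s /a -surjective_pairing.
exact: coded_chain_law.
Qed.

End Existence.

Lemma measurable_fun_random_elt (R : realType) (d : measure_display)
    (Omega : measurableType d) (I : finType) (X : Omega -> I) (f : I -> R) :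
  is_random_elt X -> measurable_fun setT (fun w => f (X w)).
Proof.
move=> mX _ Y mY; rewrite setTI.
rewrite (_ : _ @^-1` _ = \bigcup_(x in [set x | Y (f x)]) [set w | X w = x]).
  by apply: fin_bigcup_measurable => [|x _]; [exact: finite_finset|exact: mX].
apply/seteqP; split => w /=; first by exists (X w).
by move=> [x /= Yx ->].
Qed.

Section DiscountedSeries.
Variables (R : realType) (T : finType) (k : T -> T -> R) (r : T -> R) (g : R).
Hypotheses (k_dist : forall z, is_dist (k z)) (r01 : forall z, 0 <= r z <= 1)
  (g01 : 0 <= g < 1).

Lemma is_cvg_discounted (u : nat -> R) : (forall n, 0 <= u n <= 1) ->
  cvgn (series (fun n => g ^+ n * u n)).
Proof.
move=> u01; have [g0 g1] := andP g01.
apply: (@series_le_cvg _ _ (geometric 1 g)) => [n|n|n|].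
- by have /andP[u0 _] := u01 n; rewrite mulr_ge0 ?exprn_ge0.
- by rewrite /= mul1r exprn_ge0.
- by have /andP[_ u1] := u01 n; rewrite /= mul1r ler_piMr ?exprn_ge0.
- by apply: is_cvg_geometric_series; rewrite ger0_norm.
Qed.

Lemma kpow_itv n z : 0 <= kpow k n r z <= 1.
Proof.
apply/andP; split.
  rewrite -[leLHS](pathE_cst k_dist n z).
  by apply: le_pathE => // l _; have /andP[] := r01 (last z l).
by apply: pathE_le => // l _; have /andP[] := r01 (last z l).
Qed.

Definition chain_value z := limn (series (fun n => g ^+ n * kpow k n r z)).

(** The partial sums satisfy the one-step relation exactly, with index n + 1 on the left and n on
    the right, and the relation passes to the limit. *)
Lemma chain_value_fixpoint z :
  chain_value z = r z + g * \sum_z' k z z' * chain_value z'.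
Proof.
have cv z' : series (fun n => g ^+ n * kpow k n r z') @ \oo --> chain_value z'.
  by apply: is_cvg_discounted => n; exact: kpow_itv.
have uS : [sequence series (fun n => g ^+ n * kpow k n r z) n.+1]_n =
   (fun n => r z + g * \sum_z' k z z' * series (fun n => g ^+ n * kpow k n r z') n).
  apply/funext => n; rewrite /= /series/= !big_mkord big_ord_recl/= expr0 mul1r; congr (_ + _).
  rewrite mulr_sumr; under [RHS]eq_bigr do rewrite big_mkord !mulr_sumr.
  rewrite exchange_big/=; apply: eq_bigr => i _.
  rewrite kpowS exprS mulr_sumr; apply: eq_bigr => z' _; ring.
have := cv z; rewrite -cvg_shiftS uS => cvS; apply: (cvg_unique _ cvS) => //.
apply: cvgD; first exact: cvg_cst.
apply: cvgMl_tmp; apply: cvg_big => [|z' _]; last exact: cvgMl_tmp.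
exact: add_continuous.
Qed.

End DiscountedSeries.

Section ActionValue.
Variables (R : realType) (S A : finType) (M : mdp R S A) (pi : S -> A -> R).
Hypothesis pi_policy : is_policy pi.

Let k := policy_kernel M pi.
Let kd := policy_kernel_dist M pi_policy.
Let r (z : S * A) := reward M z.1 z.2.
Let r01 z : 0 <= r z <= 1 := reward_itv M z.1 z.2.
Let g01 := discount_itv M.

(** Rewards are nonnegative, so series and integral commute by monotone convergence, and each term
    is an expectation over a finite trajectory. The result is the same for every process realising
    the policy, which gives the uniqueness behind [Qval]. *)
Lemma expectation_discounted_return z0 (d : measure_display)
    (Omega : measurableType d) (Pr : probability Omega R)
    (s : nat -> Omega -> S) (a : nat -> Omega -> A) :
  policy_process M pi z0.1 z0.2 Pr s a ->
  ('E_Pr[fun w => discounted_return M (s ^~ w) (a ^~ w)] =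
   (chain_value k r (discount M) z0)%:E)%E.
Proof.
move=> proc; have [meas start _ _] := proc.
have [g0 g1] := andP g01.
have law N : chain_law Pr k (fun n w => (s n.+1 w, a n.+1 w)) z0 N.
  exact: policy_process_law.
pose u n w := discount M ^+ n * r (s n w, a n w).
have u0 n w : 0 <= u n w.
  by rewrite mulr_ge0 ?exprn_ge0//; have /andP[] := r01 (s n w, a n w).
have Eu n : (\int[Pr]_w (u n w)%:E = (discount M ^+ n * kpow k n r z0)%:E)%E.
  have := expectation_traj (fun l => discount M ^+ n * r (last z0 l)) (law n) (leqnn n).
  rewrite pathEZ => <-; rewrite unlock; apply: eq_integral => w _.
  by rewrite last_policy_traj.
have mu n : measurable_fun setT (u n).
  apply: (@measurable_fun_random_elt _ _ _ _ (fun w => (s n w, a n w))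
     (fun z => discount M ^+ n * r z)) => -[x y].
  rewrite (_ : [set _ | _] = [set w | s n w = x] `&` [set w | a n w = y]).
    by apply: measurableI; have [ms ma] := meas n; [exact: ms|exact: ma].
  by apply/seteqP; split => w /=; [move=> [<- <-]|move=> [-> ->]].
rewrite unlock.
transitivity (\int[Pr]_w (\sum_(0 <= n <oo) (u n w)%:E))%E.
  apply: eq_integral => w _; rewrite /discounted_return.
  rewrite -EFin_lim; last first.
    by apply: is_cvg_discounted => // n; exact: r01 (s n w, a n w).
  by congr (lim (_ @ \oo)); apply/funext => n; rewrite /= /series/= sumEFin.
rewrite integral_nneseries//; last 2 first.
- by move=> n; exact/measurable_EFinP.
- by move=> n w _; rewrite lee_fin.
under eq_eseriesr do rewrite Eu.
rewrite /chain_value -EFin_lim; last first.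
  by apply: is_cvg_discounted => // n; exact: kpow_itv.
by congr (lim (_ @ \oo)); apply/funext => n; rewrite /= /series/= sumEFin.
Qed.

Lemma QvalE s a : Qval M pi s a = chain_value k r (discount M) (s, a).
Proof.
apply: xget_unique => [|q].
  have proc := coded_policy_process M pi_policy (s, a).
  do 5 eexists; split; first exact: proc.
  exact: expectation_discounted_return proc.
case=> disp []Omega []Pr []s' []a' []proc.
by rewrite (@expectation_discounted_return (s, a) _ _ _ _ _ proc) => -[].
Qed.

Definition bellman (Q : S -> A -> R) s a :=
  reward M s a + discount M * \sum_s' transition M s a s' * (\sum_a' pi s' a' * Q s' a').

Lemma Qval_bellman s a : Qval M pi s a = bellman (Qval M pi) s a.
Proof.
rewrite QvalE chain_value_fixpoint// /bellman -(sum_policy_kernel M pi (s, a)).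
congr (_ + _ * _); apply: eq_bigr => -[s' a'] _; by rewrite QvalE.
Qed.

End ActionValue.

(** * Optimality equation *)

Section Optimality.
Variables (R : realType) (S A : finType) (M : mdp R S A).
Implicit Types (pi Q : S -> A -> R).

Let g0 : 0 <= discount M. Proof. by have /andP[] := discount_itv M. Qed.

Definition bellman_opt Q s a :=
  reward M s a + discount M * \sum_s' transition M s a s' * maxf (Q s').

Lemma bellmanB pi Q Q' s a :
  bellman M pi Q s a - bellman M pi Q' s a =
  discount M * \sum_s' transition M s a s' *
    (\sum_a' pi s' a' * (Q s' a' - Q' s' a')).
Proof.
rewrite /bellman opprD addrACA subrr add0r -mulrBr -sumrB; congr (_ * _).
apply: eq_bigr => s' _; rewrite -mulrBr -sumrB; congr (_ * _).
by apply: eq_bigr => a' _; rewrite mulrBr.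
Qed.

(** A one-sided contraction with [m] of any sign, the shape of the hypothesis of
    [contraction_bound]. *)
Lemma bellmanB_le pi Q Q' m s a : is_policy pi ->
  (forall s a, Q s a - Q' s a <= m) ->
  bellman M pi Q s a - bellman M pi Q' s a <= discount M * m.
Proof.
move=> ppi Qm; rewrite bellmanB ler_wpM2l//.
apply: dist_mean_le => [|s']; first exact: transition_dist.
exact: dist_mean_le.
Qed.

Lemma le_bellman_opt pi Q s a : is_policy pi ->
  bellman M pi Q s a <= bellman_opt Q s a.
Proof.
move=> ppi; rewrite lerD2l ler_wpM2l//; apply: ler_sum => s' _.
rewrite ler_wpM2l ?(transition_dist M s a).1//.
by apply: dist_mean_le => // a'; exact: le_maxf.
Qed.

Lemma bellman_opt_norm Q Q' m s a : (forall s a, `|Q s a - Q' s a| <= m) ->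
  `|bellman_opt Q s a - bellman_opt Q' s a| <= discount M * m.
Proof.
move=> QQ'; rewrite /bellman_opt opprD addrACA subrr add0r -mulrBr -sumrB.
rewrite normrM ger0_norm// ler_wpM2l//.
under eq_bigr do rewrite -mulrBr.
apply: dist_mean_norm => [|s']; first exact: transition_dist.
have [b Qb] := maxf_attained (Q s') a; have [b' Qb'] := maxf_attained (Q' s') a.
have := QQ' s' b; have := QQ' s' b'; rewrite !ler_norml => /andP[? ?] /andP[? ?].
have := le_maxf (Q s') b'; have := le_maxf (Q' s') b; rewrite Qb Qb' => ? ?.
by apply/andP; split; lra.
Qed.

(** Comparison principle: the excess of a subsolution over the fixed point contracts, so its maximum
    cannot be positive. Applied to constants it bounds the values, and applied to a greedy policy it
    is policy improvement. *)
Lemma le_Qval pi Q : is_policy pi ->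
  (forall s a, Q s a <= bellman M pi Q s a) -> forall s a, Q s a <= Qval M pi s a.
Proof.
move=> ppi QB s a; rewrite -subr_le0.
suff: Q s a - Qval M pi s a <= 0 / (1 - discount M) by rewrite mul0r.
apply: (@contraction_bound R (S * A)%type (fun z => Q z.1 z.2 - Qval M pi z.1 z.2)
  (discount M) 0 (discount_itv M) _ (s, a)) => m Qm [s' a'] /=.
have := @bellmanB_le pi Q (Qval M pi) m s' a' ppi (fun x y => Qm (x, y)).
have := QB s' a'; rewrite -Qval_bellman//; lra.
Qed.

Lemma Qval_le pi Q : is_policy pi ->
  (forall s a, bellman M pi Q s a <= Q s a) -> forall s a, Qval M pi s a <= Q s a.
Proof.
move=> ppi QB s a; rewrite -subr_le0.
suff: Qval M pi s a - Q s a <= 0 / (1 - discount M) by rewrite mul0r.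
apply: (@contraction_bound R (S * A)%type (fun z => Qval M pi z.1 z.2 - Q z.1 z.2)
  (discount M) 0 (discount_itv M) _ (s, a)) => m Qm [s' a'] /=.
have := @bellmanB_le pi (Qval M pi) Q m s' a' ppi (fun x y => Qm (x, y)).
have := QB s' a'; rewrite -Qval_bellman//; lra.
Qed.

Lemma bellman_itv pi Q s a : is_policy pi ->
  (forall s a, 0 <= Q s a <= (1 - discount M)^-1) ->
  0 <= bellman M pi Q s a <= (1 - discount M)^-1.
Proof.
move=> ppi Q01; have /andP[r0 r1] := reward_itv M s a.
have /andP[_ g1] := discount_itv M.
apply/andP; split.
  rewrite addr_ge0// mulr_ge0//; apply: dist_mean_ge => [|s']; first exact: transition_dist.
  by apply: dist_mean_ge => // a'; have /andP[] := Q01 s' a'.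
have avg : \sum_s' transition M s a s' * (\sum_a' pi s' a' * Q s' a') <= (1 - discount M)^-1.
  apply: dist_mean_le => [|s']; first exact: transition_dist.
  by apply: dist_mean_le => // a'; have /andP[] := Q01 s' a'.
have g1' : 1 - discount M != 0 by rewrite subr_eq0 gt_eqF.
have -> : (1 - discount M)^-1 = 1 + discount M * (1 - discount M)^-1 by field.
by rewrite lerD// ler_wpM2l.
Qed.

Lemma Qval_itv pi s a : is_policy pi -> 0 <= Qval M pi s a <= (1 - discount M)^-1.
Proof.
move=> ppi; have /andP[_ g1] := discount_itv M.
have V0 : 0 <= (1 - discount M)^-1 by rewrite invr_ge0 subr_ge0 ltW.
apply/andP; split.
  apply: (@le_Qval pi (fun _ _ => 0)) => // x y.
  by have /(_ _)/andP[] := @bellman_itv pi (fun _ _ => 0) x y ppi; rewrite ?lexx.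
apply: (@Qval_le pi (fun _ _ => (1 - discount M)^-1)) => // x y.
have /(_ _)/andP[] := @bellman_itv pi (fun _ _ => (1 - discount M)^-1) x y ppi => //.
by rewrite V0 lexx.
Qed.

Definition det_policy (f : {ffun S -> A}) s a : R := (a == f s)%:R.

Lemma sum_det_policy f s (u : A -> R) : \sum_a det_policy f s a * u a = u (f s).
Proof.
rewrite (bigD1 (f s))//= big1 => [|b /negbTE bf]; rewrite /det_policy.
  by rewrite eqxx mul1r addr0.
by rewrite bf mul0r.
Qed.

Lemma det_policyP f : is_policy (det_policy f).
Proof.
move=> s; split=> [a|]; first exact: ler0n.
by rewrite -[RHS](sum_det_policy f s (fun=> 1)); apply: eq_bigr => a _; rewrite mulr1.
Qed.

(* Among the finitely many deterministic policies take one of maximal total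
   value: policy improvement cannot increase it, hence it is a fixed point. *)
Lemma optimal_det_policy : (0 < #|A|)%N ->
  exists f, forall s a,
    Qval M (det_policy f) s a = bellman_opt (Qval M (det_policy f)) s a.
Proof.
move=> /card_gt0P[a0 _].
pose q f := Qval M (det_policy f).
have [f _ fmax] := @arg_maxP _ _ _ [ffun=> a0] xpredT
  (fun f => \sum_z q f z.1 z.2) isT.
exists f.
have gr s : exists b, maxf (q f s) == q f s b.
  by have [b ->] := maxf_attained (q f s) a0; exists b.
pose f' := [ffun s => xchoose (gr s)].
have optE s a : bellman M (det_policy f') (q f) s a = bellman_opt (q f) s a.
  congr (_ + _ * _); apply: eq_bigr => s' _.
  by rewrite sum_det_policy ffunE -(eqP (xchooseP (gr s'))).
have opt_ge s a : q f s a <= bellman_opt (q f) s a.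
  by rewrite /q {1}Qval_bellman; [exact: le_bellman_opt (det_policyP f)|exact: det_policyP].
have ff' s a : q f s a <= q f' s a.
  by apply: le_Qval; [exact: det_policyP|move=> x y; rewrite optE].
have fopt s a : bellman_opt (q f) s a <= q f' s a.
  rewrite -optE [leRHS]Qval_bellman ?[q f']/q; last exact: det_policyP.
  rewrite -subr_le0; have := @bellmanB_le (det_policy f') (q f) (q f') 0 s a (det_policyP _).
  by rewrite mulr0; apply => x y; rewrite subr_le0.
have sum0 : \sum_z (q f' z.1 z.2 - q f z.1 z.2) <= 0.
  by rewrite sumrB subr_le0; exact: fmax.
have d0 z : 0 <= q f' z.1 z.2 - q f z.1 z.2 by rewrite subr_ge0.
move=> s a; apply/eqP; rewrite eq_le opt_ge/= (le_trans (fopt s a))//.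
rewrite -subr_le0 (le_trans _ sum0)// (bigD1 (s, a))//= lerDl.
exact: sumr_ge0.
Qed.

Hypothesis A0 : (0 < #|A|)%N.

(** The value of the deterministic policy solves the optimality equation, hence is a supersolution
    for every policy, and comparison makes it an upper bound of the set defining [Qstar]. *)
Lemma Qstar_attained : exists2 pi, is_policy pi &
  (forall s a, Qstar M s a = Qval M pi s a) /\
  (forall s a, Qval M pi s a = bellman_opt (Qval M pi) s a).
Proof.
have [f fE] := optimal_det_policy A0; exists (det_policy f); first exact: det_policyP.
split=> // s a.
have fub : ubound [set Qval M pi s a | pi in [set pi | is_policy pi]] (Qval M (det_policy f) s a).
  move=> _ [pi /= ppi <-]; apply: Qval_le => // x y.
  by rewrite [leRHS]fE le_bellman_opt.
apply/eqP; rewrite eq_le; apply/andP; split.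
  apply: ge_sup => //; exists (Qval M (det_policy f) s a), (det_policy f) => //.
  exact: det_policyP.
apply: sup_upper_bound; last by exists (det_policy f) => //; exact: det_policyP.
split; last by exists (Qval M (det_policy f) s a).
by exists (Qval M (det_policy f) s a), (det_policy f) => //; exact: det_policyP.
Qed.

Lemma Qstar_fixpoint s a : Qstar M s a = bellman_opt (Qstar M) s a.
Proof.
have [pi _ [QE fE]] := Qstar_attained; rewrite QE fE /bellman_opt.
congr (_ + _ * _); apply: eq_bigr => s' _; congr (_ * _).
by congr maxf; apply/funext => b; rewrite QE.
Qed.

Lemma Qstar_itv s a : 0 <= Qstar M s a <= (1 - discount M)^-1.
Proof. by have [pi ppi [-> _]] := Qstar_attained; exact: Qval_itv. Qed.

Lemma Qval_le_Qstar pi s a : is_policy pi -> Qval M pi s a <= Qstar M s a.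
Proof.
move=> ppi; apply: Qval_le => // x y.
by rewrite [leRHS]Qstar_fixpoint le_bellman_opt.
Qed.

End Optimality.

(** * Essentially smooth convex functions *)

Section RowVectors.
Variables (R : realType) (n : nat).
Implicit Types (u v x y : 'rV[R]_n) (C : set 'rV[R]_n) (f : 'rV[R]_n -> R).

Lemma dotDr u x y : dot u (x + y) = dot u x + dot u y.
Proof. by rewrite -big_split; apply: eq_bigr => i _; rewrite mxE mulrDr. Qed.

Lemma dotZr u (c : R) x : dot u (c *: x) = c * dot u x.
Proof. by rewrite mulr_sumr; apply: eq_bigr => i _; rewrite mxE mulrCA. Qed.

Lemma dotNr u x : dot u (- x) = - dot u x.
Proof. by rewrite -scaleN1r dotZr mulN1r. Qed.

Lemma dotBr u x y : dot u (x - y) = dot u x - dot u y.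
Proof. by rewrite dotDr dotNr. Qed.

Lemma interior_ballP C x : C^° x <->
  exists2 e : R, 0 < e & forall y, `|y - x| < e -> C y.
Proof.
split.
  move=> /nbhs_ballP[e /= e0 eC]; exists e => // y xy; apply: eC.
  by rewrite -ball_normE /ball_ /= distrC.
move=> [e e0 eC]; apply/nbhs_ballP; exists e => // y.
by rewrite -ball_normE /ball_ /= distrC; exact: eC.
Qed.

(** The norm of a row vector is the max norm, so a signed unit vector at a coordinate of largest
    modulus will do. *)
Lemma dot_norm u : exists2 v, `|v| <= 1 & dot u v = `|u|.
Proof.
have [->|u0] := eqVneq u 0.
  exists 0; first by rewrite normr0.
  by rewrite normr0 /dot big1// => i _; rewrite !mxE mul0r.
have [|[i j] /= uE] := @mx_norm_neq0 R 1 n u.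
  by apply: contra u0 => /eqP/mx_norm_eq0 ->.
exists (Num.sg (u i j) *: delta_mx ord0 j).
  rewrite [leLHS]mx_normrE; apply/bigmax_leP; split=> // -[i' j'] _ /=.
  rewrite !mxE normrM normr_sg; case: (_ && _); rewrite ?normr0 ?normr1 ?mulr0//.
  by rewrite mulr1; case: (_ != _).
rewrite [RHS]uE dotZr /dot (bigD1 j)//= big1 => [|j' j'j].
  by rewrite mxE !eqxx mulr1 addr0 (ord1 i) -normrEsg.
by rewrite mxE (negbTE j'j) andbF mulr0.
Qed.

(** Any [y] lies on a line through [x] and a nearby point of [C]. The coefficient [t^-1] of the
    combination may exceed 1, as affine combinations allow. *)
Lemma affine_hull_interior C x y : C^° x -> smallest (@is_affine R n) C y.
Proof.
move=> /interior_ballP[e e0 eC] E [Eaff CE].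
(* The added 1 keeps the denominator positive when y = x. *)
pose t := e / (2 * (1 + `|y - x|)).
have d0 : 0 < 1 + `|y - x| by rewrite ltr_wpDr.
have t0 : 0 < t by rewrite divr_gt0// mulr_gt0.
have Ex : E x by apply/CE/eC; rewrite subrr normr0.
have Ez : E (x + t *: (y - x)).
  apply/CE/eC; rewrite addrC addKr normrZ gtr0_norm//.
  rewrite /t mulrAC ltr_pdivrMr ?mulr_gt0// ltr_pM2l//.
  by have := normr_ge0 (y - x); lra.
have -> : y = t^-1 *: (x + t *: (y - x)) + (1 - t^-1) *: x; last exact: Eaff.
by apply/rowP => i; rewrite !mxE; field; rewrite gt_eqF.
Qed.

Lemma rint_interior C x : C^° !=set0 -> rint C x -> C^° x.
Proof.
move=> [y Cy] [_ xC]; apply: filterS xC => z; apply.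
exact: affine_hull_interior Cy.
Qed.

Lemma derive_grad f x v : differentiable f x -> 'D_v f x = dot (grad f x) v.
Proof.
move=> df; rewrite deriveE// {1}(row_sum_delta v) linear_sum.
by apply: eq_bigr => i _; rewrite linearZ/= mxE deriveE// mulrC.
Qed.

End RowVectors.

Section ConvexFunctions.
Variables (R : realType) (n : nat) (h : 'rV[R]_n -> \bar R).
Hypotheses (h_proper : proper_fun h) (h_convex : strictly_convex_fun h).
Implicit Types (x y p u : 'rV[R]_n).

Let f := fine \o h.

Lemma dom_fineK x : dom h x -> h x = (f x)%:E.
Proof.
rewrite /dom /f /= => hx; rewrite fineK// fin_numElt hx andbT; exact: h_proper.1.
Qed.

Lemma dom_conv x y (t : R) : dom h x -> dom h y -> 0 <= t <= 1 ->
  dom h (t *: x + (1 - t) *: y) /\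
  f (t *: x + (1 - t) *: y) <= t * f x + (1 - t) * f y.
Proof.
move=> hx hy /andP[t0 t1].
have [->|tn0] := eqVneq t 0.
  by rewrite scale0r add0r subr0 scale1r mul0r mul1r add0r.
have [->|tn1] := eqVneq t 1.
  by rewrite scale1r subrr scale0r addr0 mul1r mul0r addr0.
have [->|xy] := eqVneq x y.
  by rewrite -scalerDl -mulrDl (_ : t + (1 - t) = 1) ?scale1r ?mul1r//; ring.
have t01 : 0 < t < 1 by rewrite !lt_neqAle eq_sym tn0 t0 tn1 t1.
have := h_convex hx hy xy t01; rewrite (dom_fineK hx) (dom_fineK hy) => hc.
have hd : dom h (t *: x + (1 - t) *: y) by exact: lt_trans hc (ltry _).
split=> //; rewrite -lee_fin -dom_fineK//; exact: ltW.
Qed.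

Lemma strict_conv x y (t : R) : dom h x -> dom h y -> x != y -> 0 < t < 1 ->
  f (t *: x + (1 - t) *: y) < t * f x + (1 - t) * f y.
Proof.
move=> hx hy xy t01; have /andP[t0 t1] := t01.
have t01' : 0 <= t <= 1 by rewrite !ltW.
have [hd _] := dom_conv hx hy t01'.
have := h_convex hx hy xy t01; rewrite (dom_fineK hx) (dom_fineK hy).
by rewrite (dom_fineK hd) -!EFinM -EFinD lte_fin.
Qed.

(** The directional derivative is a limit from the right of difference quotients, each at most f y -
    f x by convexity. *)
Lemma gradient_le x y : dom h x -> differentiable f x -> dom h y ->
  f x + dot (grad f x) (y - x) <= f y.
Proof.
move=> hx df hy; rewrite -derive_grad// -lerBrDl.
have := @diff_derivable _ _ _ f x (y - x) df.
rewrite /derivable /derive => /cvg_dnbhs_at_right dcv.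
rewrite -(cvg_lim _ dcv)//; apply: limr_le; first exact: cvgP dcv.
near=> t.
have t0 : 0 < t by near: t; exact: nbhs_right_gt.
have t1 : t < 1 by near: t; exact: nbhs_right_lt.
rewrite /GRing.scale/= ler_pdivrMl//.
have -> : t *: (y - x) + x = t *: y + (1 - t) *: x.
  by apply/rowP => i; rewrite !mxE; ring.
have t01 : 0 <= t <= 1 by rewrite !ltW.
by have [_] := dom_conv hy hx t01; lra.
Unshelve. all: by end_near. Qed.

(** The homothety of centre [p] and ratio [t] shrinks a ball around [x] inside the domain to one of
    radius t e, still inside by convexity. *)
Lemma interior_dom_conv x p (t : R) : (dom h)^° x -> dom h p -> 0 < t <= 1 ->
  (dom h)^° (t *: x + (1 - t) *: p).
Proof.
move=> /interior_ballP[e e0 eC] hp /andP[t0 t1].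
apply/interior_ballP; exists (t * e); first exact: mulr_gt0.
move=> y ye; pose x' := t^-1 *: (y - (1 - t) *: p).
have -> : y = t *: x' + (1 - t) *: p.
  by rewrite scalerA divff ?gt_eqF// scale1r subrK.
apply: (@dom_conv x' p t _ hp _).1; last by rewrite ltW.
apply: eC; have -> : x' - x = t^-1 *: (y - (t *: x + (1 - t) *: p)).
  by apply/rowP => i; rewrite !mxE; field; rewrite gt_eqF.
by rewrite normrZ gtr0_norm ?invr_gt0// mulrC ltr_pdivrMr// mulrC.
Qed.

Hypothesis h_smooth : essentially_smooth h.

Let h_diff x : (dom h)^° x -> differentiable f x.
Proof. by have [_ hd _] := h_smooth; exact: hd. Qed.

Let int_dom x : (dom h)^° x -> dom h x.
Proof. exact: interior_subset. Qed.

(* Along the segment from a boundary point p to an interior point u the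
   gradient blows up; testing the gradient inequality at points of a ball
   around u shows that the slope towards u is unbounded below. *)
Lemma boundary_slope p u (c : R) : (dom h)^° u -> dom h p ->
  (forall t : R, 0 < t <= 1 -> t * c <= f (t *: u + (1 - t) *: p) - f p) ->
  (dom h)^° p.
Proof.
move=> hu hp slope; apply: contrapT => np.
pose t i : R := i.+1%:R^-1.
have t0 i : 0 < t i by rewrite invr_gt0.
have t1 i : t i <= 1 by rewrite invf_le1// ler1n.
have t01 i : 0 < t i <= 1 by rewrite t0 t1.
pose x i := t i *: u + (1 - t i) *: p.
have hx i : (dom h)^° (x i) := interior_dom_conv hu hp (t01 i).
have xp : x @ \oo --> p.
  have -> : x = (fun i => p + harmonic i *: (u - p)).
    by apply/funext => i; rewrite -[harmonic i]/(t i) /x; apply/rowP => j; rewrite !mxE; ring.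
  rewrite -[X in _ --> X]addr0 -(scale0r (u - p)).
  apply: cvgD; first exact: cvg_cst.
  by apply: cvgZr_tmp; exact: cvg_harmonic.
have [_ _ /(_ x p hx xp)] := h_smooth.
have pb : (closure (dom h) `\` (dom h)^°) p by split => //; exact: subset_closure.
move=> /(_ pb) /cvgryPge blow.
have [e1 e10 he1] := (interior_ballP _ _).1 hu.
have : \forall y \near u, f y <= f u + 1.
  have := differentiable_continuous (h_diff hu).
  move=> /cvgr_le /(_ (f u + 1)); apply; rewrite ltrDl; exact: ltr01.
move=> /(interior_ballP [set y | f y <= f u + 1])[e2 e20 he2].
(* Within distance [e] of [u] the function is finite and at most f u + 1. *)
pose e := Num.min e1 e2 / 2.
have e0 : 0 < e by rewrite divr_gt0// lt_min e10.
have e12 : e < e1 /\ e < e2.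
  by rewrite /e; case: (leP e1 e2) => ?; split; lra.
pose L := `|dot (grad f u) (p - u)|.
(* The gradient inequalities below force e |g| <= 1 + L + |c|, so the threshold 2 + L + |c| gives
   the contradiction. *)
have [N _ /(_ N (leqnn N)) /=] := blow ((2 + L + `|c|) / e).
set g := grad _ _ => gN.
have gx y : dom h y -> f (x N) + dot g (y - x N) <= f y.
  exact: (gradient_le (int_dom (hx N)) (h_diff (hx N))).
have [v v1 vg] := dot_norm g.
have hv : dom h (u + e *: v) /\ f (u + e *: v) <= f u + 1.
  have ve : `|u + e *: v - u| <= e.
    by rewrite addrC addKr normrZ gtr0_norm// ler_piMr// ltW.
  by split; [apply: he1|apply: he2]; apply: le_lt_trans ve _; case: e12.
have := gx _ hv.1; have := gx _ hp; have := slope _ (t01 N).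
have := gradient_le (int_dom hu) (h_diff hu) (int_dom (hx N)).
rewrite -/(x N).
have -> : x N - u = (1 - t N) *: (p - u) by rewrite /x; apply/rowP => j; rewrite !mxE; ring.
have -> : p - x N = - t N *: (u - p) by rewrite /x; apply/rowP => j; rewrite !mxE; ring.
have -> : u + e *: v - x N = (1 - t N) *: (u - p) + e *: v.
  by rewrite /x; apply/rowP => j; rewrite !mxE; ring.
rewrite dotDr !dotZr vg => lower sl slp up.
(* The slope hypothesis bounds f (x N) - f p below, the gradient inequality tested at [p] bounds it
   above; divide by t N. *)
have slopeN : c <= dot g (u - p).
  by rewrite -(ler_pM2l (t0 N)); lra.
have eg : 2 + L + `|c| <= e * `|g| by rewrite -ler_pdivrMl// mulrC.
have q0 : 0 <= 1 - t N by rewrite subr_ge0.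
have q1 : 1 - t N <= 1 by have := t0 N; lra.
have cN : - `|c| <= (1 - t N) * dot g (u - p).
  apply: (@le_trans _ _ ((1 - t N) * c)); last exact: ler_wpM2l.
  rewrite lerNl -mulrN (le_trans (ler_norm _))// normrM normrN ger0_norm//.
  by rewrite ler_piMl.
have LN : - L <= (1 - t N) * dot (grad f u) (p - u).
  rewrite lerNl -mulrN (le_trans (ler_norm _))// normrM normrN ger0_norm//.
  by rewrite ler_piMl.
have fv := hv.2; lra.
Qed.

End ConvexFunctions.

(** * The mirror step: uniqueness, interiority and gap to any competitor *)

Section MirrorStep.
Variables (R : realType) (A : finType) (h : 'rV[R]_#|A| -> \bar R).
Hypothesis hh : mirror_map h.
Implicit Types (p q Q : A -> R).

Definition mix (t : R) p q : A -> R := fun b => t * p b + (1 - t) * q b.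

Lemma mix_dist t p q : is_dist p -> is_dist q -> 0 <= t <= 1 -> is_dist (mix t p q).
Proof.
move=> [p0 p1] [q0 q1] /andP[t0 t1]; split=> [b|].
  by rewrite addr_ge0// mulr_ge0// subr_ge0.
by rewrite big_split/= -!mulr_sumr p1 q1 !mulr1 addrC subrK.
Qed.

Lemma vec_mix t p q : vec (mix t p q) = t *: vec p + (1 - t) *: vec q.
Proof. by apply/rowP => i; rewrite !mxE. Qed.

Lemma vec_inj p q : vec p = vec q -> p = q.
Proof.
move=> /rowP pq; apply/funext => b.
by have := pq (enum_rank b); rewrite !mxE enum_rankK.
Qed.

Let h_proper : proper_fun h. Proof. by have [[]] := hh. Qed.
Let h_convex : strictly_convex_fun h. Proof. by have [[]] := hh. Qed.
Let h_smooth : essentially_smooth h. Proof. by have [[]] := hh. Qed.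
Let dist_dom p : is_dist p -> dom h (vec p).
Proof. by have [_ hd _] := hh; exact: hd. Qed.

Lemma mirror_rint x : rint (dom h) x -> (dom h)^° x.
Proof. by apply: rint_interior; have [] := h_smooth. Qed.

Lemma bregman_ge0 p q : is_dist p -> (dom h)^° (vec q) -> 0 <= bregman h p q.
Proof.
move=> /dist_dom hp hq; have [_ hd _] := h_smooth.
have := gradient_le h_proper h_convex (interior_subset hq) (hd _ hq) hp.
by rewrite /bregman /=; lra.
Qed.

Let objective (c : R) Q q p := c * (\sum_b p b * Q b) - bregman h p q.

(** The linear terms cancel, so the objective deviates from affine exactly by the convexity gap of
    [h]. *)
Let objective_mix c Q q t p p' :
  objective c Q q (mix t p p') =
  t * objective c Q q p + (1 - t) * objective c Q q p' +
  (t * fine (h (vec p)) + (1 - t) * fine (h (vec p')) - fine (h (vec (mix t p p')))).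
Proof.
rewrite /objective /bregman.
have -> : \sum_b mix t p p' b * Q b = t * (\sum_b p b * Q b) + (1 - t) * (\sum_b p' b * Q b).
  rewrite !mulr_sumr -big_split/=; apply: eq_bigr => b _; rewrite /mix; ring.
rewrite !dotBr vec_mix dotDr !dotZr; ring.
Qed.

(** Two distinct maximisers would be beaten by their midpoint. This makes the actor update a
    function of the current policy and critic, although the run states it only as a relation. *)
Lemma argmax_dist_unique c Q q p p' :
  argmax_dist (objective c Q q) p -> argmax_dist (objective c Q q) p' -> p = p'.
Proof.
move=> [dp pmax] [dp' pmax']; apply: vec_inj; apply: contrapT => /eqP pp'.
have half : 0 < (2^-1 : R) < 1 by apply/andP; split; lra.
have half' : 0 <= (2^-1 : R) <= 1 by apply/andP; split; lra.
have := pmax _ (mix_dist dp dp' half'); rewrite objective_mix.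
have := pmax _ dp'; have := pmax' _ dp.
have := strict_conv h_proper h_convex (dist_dom dp) (dist_dom dp') pp' half.
by rewrite vec_mix /=; lra.
Qed.

(** Moving from the maximiser towards the interior point [q] cannot raise the objective, so [h]
    decreases at most linearly in that direction; this is the slope bound of [boundary_slope]. *)
Lemma argmax_dist_interior c Q q p : is_dist q -> (dom h)^° (vec q) ->
  argmax_dist (objective c Q q) p -> (dom h)^° (vec p).
Proof.
move=> dq hq [dp pmax].
apply: (boundary_slope h_proper h_convex h_smooth
  (c := objective c Q q q - objective c Q q p + (fine (h (vec q)) - fine (h (vec p)))) hq
  (dist_dom dp)) => t /andP[t0 t1].
have t01 : 0 <= t <= 1 by rewrite ltW.
have := pmax _ (mix_dist dq dp t01); rewrite objective_mix vec_mix /=; lra.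
Qed.

(** Optimality against [p'], after dropping the nonnegative divergence from [q] to the maximiser. *)
Lemma argmax_dist_gap c Q q p p' : is_dist p' -> (dom h)^° (vec q) ->
  argmax_dist (objective c Q q) p ->
  c * (\sum_b p' b * Q b - \sum_b p b * Q b) <= bregman h p' q.
Proof.
move=> dp' hq [dp pmax]; have := pmax _ dp'; have := bregman_ge0 dp hq.
by rewrite /objective; lra.
Qed.

End MirrorStep.

(** * Temporal-difference noise *)

(** The differences sum to zero, so the one at [z] is matched by the others; this absorbs the factor
    1/2 in [dTV]. *)
Lemma dist_le_dTV (R : realType) (T : finType) (p q : T -> R) z :
  is_dist p -> is_dist q -> `|p z - q z| <= dTV p q.
Proof.
move=> [_ p1] [_ q1].
have pq : p z - q z = - \sum_(y | y != z) (p y - q y).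
  rewrite sumrB; have := p1; have := q1; rewrite (bigD1 z)//= [in X in _ -> X -> _](bigD1 z)//=; lra.
rewrite /dTV (bigD1 z)//= ler_pdivlMl//.
suff : `|p z - q z| <= \sum_(y | y != z) `|p y - q y| by lra.
by rewrite pq normrN ler_norm_sum.
Qed.

Section BehaviorChain.
Variables (R : realType) (S A : finType) (M : mdp R S A) (pib : S -> A -> R).
Hypothesis pib_policy : is_policy pib.

(* A state of this chain is a transition's action and end state; the next
   transition depends on the end state only. *)
Definition behavior_kernel (z z' : A * S) : R :=
  pib z.2 z'.1 * transition M z.2 z'.1 z'.2.

Lemma sum_behavior_kernel z (F : A -> S -> R) :
  \sum_z' behavior_kernel z z' * F z'.1 z'.2 =
  \sum_a pib z.2 a * \sum_s' transition M z.2 a s' * F a s'.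
Proof.
under [RHS]eq_bigr do rewrite mulr_sumr.
by rewrite pair_big/=; apply: eq_bigr => -[a s'] _; rewrite /= mulrA.
Qed.

Lemma behavior_kernel_dist z : is_dist (behavior_kernel z).
Proof.
split=> [z'|].
  by apply: mulr_ge0; [exact: (pib_policy _).1|exact: (transition_dist M _ _).1].
transitivity (\sum_z' behavior_kernel z z' * 1); first by under [RHS]eq_bigr do rewrite mulr1.
rewrite (@sum_behavior_kernel z (fun _ _ => 1)).
under eq_bigr do (under eq_bigr do rewrite mulr1; rewrite (transition_dist M _ _).2 mulr1).
exact: (pib_policy _).2.
Qed.

Lemma state_kernel_dist s : is_dist (state_kernel M pib s).
Proof.
split=> [s'|].
  apply: sumr_ge0 => a _; apply: mulr_ge0; first exact: (pib_policy _).1.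
  exact: (transition_dist M _ _).1.
rewrite exchange_big/=; under eq_bigr do rewrite -mulr_sumr (transition_dist M _ _).2 mulr1.
exact: (pib_policy _).2.
Qed.

(** Transfers the mixing hypothesis, stated for the state chain, to the chain of transitions. *)
Lemma kpow_state t (f : S -> R) z :
  kpow behavior_kernel t (fun y => f y.2) z =
  \sum_s nstep (state_kernel M pib) t z.2 s * f s.
Proof.
elim: t f => [|t IH] f.
  rewrite /kpow /= (bigD1 z.2)//= eqxx mul1r big1 ?addr0// => s /negbTE.
  by rewrite eq_sym => ->; rewrite mul0r.
rewrite kpowSr -[LHS]/(kpow behavior_kernel t _ z).
under [X in kpow _ _ X]eq_fun do rewrite (@sum_behavior_kernel _ (fun _ s => f s)).
rewrite (IH (fun s => \sum_a pib s a * \sum_s' transition M s a s' * f s'))/=.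
under [RHS]eq_bigr do rewrite mulr_suml.
rewrite exchange_big/=; apply: eq_bigr => s _; rewrite /state_kernel.
under [RHS]eq_bigr do rewrite -mulrA mulr_suml.
rewrite -mulr_sumr exchange_big/=; congr (_ * _); apply: eq_bigr => a _.
by rewrite mulr_sumr; apply: eq_bigr => s' _; rewrite mulrA.
Qed.

Lemma nstep_dist t s : is_dist (nstep (state_kernel M pib) t s).
Proof.
elim: t => [|t IH].
  split=> [s'|]; first exact: ler0n.
  by rewrite (bigD1 s)//= eqxx big1 ?addr0// => s' /negbTE; rewrite eq_sym => ->.
split=> [s'|] /=.
  by apply: sumr_ge0 => s1 _; rewrite mulr_ge0 ?IH.1 ?(state_kernel_dist _).1.
rewrite exchange_big/=; under eq_bigr do rewrite -mulr_sumr (state_kernel_dist _).2 mulr1.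
exact: IH.2.
Qed.

(** Some state carries mass; irreducibility moves part of it to [s] in t steps, and [nu] is
    invariant under t steps. *)
Lemma stationary_pos nu s : irreducible_chain (state_kernel M pib) ->
  is_stationary (state_kernel M pib) nu -> 0 < nu s.
Proof.
move=> irr [[nu0 nu1] nuP].
have nuPt t s' : \sum_x nu x * nstep (state_kernel M pib) t x s' = nu s'.
  elim: t s' => [|t IH] s' /=.
    by rewrite (bigD1 s')//= eqxx mulr1 big1 ?addr0// => x /negbTE ->; rewrite mulr0.
  rewrite -[RHS]nuP; under eq_bigr do rewrite mulr_sumr.
  rewrite exchange_big/=; apply: eq_bigr => x _; rewrite -[in RHS](IH x) mulr_suml.
  by apply: eq_bigr => y _; rewrite mulrA.
have [x x0] : exists x, 0 < nu x.
  apply/existsP; apply: contraT; rewrite negb_exists => /forallP n0.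
  suff : (0 : R) = 1 by move/eqP; rewrite eq_sym oner_eq0.
  rewrite -nu1; apply/esym/big1 => x _; apply/eqP; rewrite eq_le nu0 andbT leNgt.
  exact: n0.
have [t xt] := irr x s.
rewrite -(nuPt t) (bigD1 x)//= ltr_pwDl ?mulr_gt0//.
by apply: sumr_ge0 => y _; rewrite mulr_ge0// (nstep_dist _ _).1.
Qed.

Section TDNoise.
Variables (pi Q : S -> A -> R).
Hypothesis pi_policy : is_policy pi.
Hypothesis Q_itv : forall s a, 0 <= Q s a <= (1 - discount M)^-1.

Let V := (1 - discount M)^-1.
Let g0 : 0 <= discount M. Proof. by have /andP[] := discount_itv M. Qed.
Let g1 : discount M < 1. Proof. by have /andP[] := discount_itv M. Qed.
Let V0 : 0 <= V. Proof. by rewrite invr_ge0 subr_ge0 ltW. Qed.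

(** Critic plus TD error is either the old entry or its bootstrapped target. Stating the bound for
    the sum makes an update with step size at most 1 a convex combination within the same interval,
    whose upper end solves V = 1 + gamma V. *)
Lemma td_error_itv st b st' s a :
  0 <= Q s a + td_error M pi Q st b st' s a <= V.
Proof.
rewrite /td_error; case: eqP => [[-> ->]|_]; last by rewrite mul0r addr0 Q_itv.
rewrite mul1r addrC subrK; have /andP[r0 r1] := reward_itv M s a.
have mQ0 : 0 <= \sum_a' pi st' a' * Q st' a'.
  by apply: dist_mean_ge => // a'; have /andP[] := Q_itv st' a'.
have mQ1 : \sum_a' pi st' a' * Q st' a' <= V.
  by apply: dist_mean_le => // a'; have /andP[] := Q_itv st' a'.
rewrite addr_ge0 ?mulr_ge0//=.
have -> : V = 1 + discount M * V.
  by rewrite /V; field; rewrite subr_eq0 gt_eqF.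
by rewrite lerD// ler_wpM2l.
Qed.

Lemma td_error_norm st b st' s a : `|td_error M pi Q st b st' s a| <= V.
Proof.
have := td_error_itv st b st' s a; have := Q_itv s a; rewrite -/V ler_norml.
by move=> /andP[? ?] /andP[? ?]; apply/andP; split; lra.
Qed.

Lemma bellman_residual_norm s a : `|bellman M pi Q s a - Q s a| <= V.
Proof.
have := bellman_itv s a pi_policy Q_itv; have := Q_itv s a; rewrite -/V ler_norml.
by move=> /andP[? ?] /andP[? ?]; apply/andP; split; lra.
Qed.

Variable nu : S -> R.
Hypothesis nu_dist : is_dist nu.

(** The subtracted term is the mean of the TD error at entry [x] when the current state has law
    [nu]. *)
Definition td_noise (x : S * A) (z z' : A * S) : R :=
  td_error M pi Q z.2 z'.1 z'.2 x.1 x.2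
  - nu x.1 * pib x.1 x.2 * (bellman M pi Q x.1 x.2 - Q x.1 x.2).

Let weight_itv x : 0 <= nu x.1 * pib x.1 x.2 <= 1.
Proof.
have [n0 p0] := (nu_dist.1 x.1, (pib_policy x.1).1 x.2).
by rewrite mulr_ge0//= mulr_ile1// dist_le1.
Qed.

Lemma td_noise_norm x z z' : `|td_noise x z z'| <= 2 * V.
Proof.
rewrite (le_trans (ler_normB _ _))// [X in _ + X]normrM.
have /andP[w0 w1] := weight_itv x; rewrite (ger0_norm w0).
have := td_error_norm z.2 z'.1 z'.2 x.1 x.2.
have := bellman_residual_norm x.1 x.2.
set d := `|_ - _| => dV ?.
have : nu x.1 * pib x.1 x.2 * d <= 1 * V by apply: ler_pM => //; exact: normr_ge0.
lra.
Qed.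

(** The current state enters only through a centred indicator, so decay of the mean noise reduces to
    mixing at the single state [x.1]. *)
Lemma td_noise_mean x z :
  \sum_z' behavior_kernel z z' * td_noise x z z' =
  ((z.2 == x.1)%:R - nu x.1) * (pib x.1 x.2 * (bellman M pi Q x.1 x.2 - Q x.1 x.2)).
Proof.
rewrite (@sum_behavior_kernel z (fun b st' => td_error M pi Q z.2 b st' x.1 x.2
  - nu x.1 * pib x.1 x.2 * (bellman M pi Q x.1 x.2 - Q x.1 x.2))).
have inner b : \sum_s' transition M z.2 b s' * (td_error M pi Q z.2 b s' x.1 x.2
      - nu x.1 * pib x.1 x.2 * (bellman M pi Q x.1 x.2 - Q x.1 x.2)) =
    ((z.2, b) == x)%:R * (bellman M pi Q x.1 x.2 - Q x.1 x.2)
      - nu x.1 * pib x.1 x.2 * (bellman M pi Q x.1 x.2 - Q x.1 x.2).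
  under eq_bigr do rewrite mulrBr.
  rewrite sumrB (dist_mean_cst _ (transition_dist M _ _)); congr (_ - _).
  rewrite /td_error -surjective_pairing.
  have [<-|_] /= := eqVneq (z.2, b) x; last by rewrite mul0r big1// => s' _; rewrite mul0r mulr0.
  rewrite mul1r.
  transitivity (\sum_s' (transition M z.2 b s' * (reward M z.2 b - Q z.2 b)
     + discount M * (transition M z.2 b s' * (\sum_a' pi s' a' * Q s' a')))).
    by apply: eq_bigr => s' _; ring.
  rewrite big_split/= (dist_mean_cst _ (transition_dist M _ _)) -mulr_sumr /bellman; ring.
under eq_bigr do rewrite inner mulrBr.
rewrite sumrB (dist_mean_cst _ (pib_policy _)) [RHS]mulrBl mulrA; congr (_ - _); last by rewrite mulrA.
case: x {inner} => s a /=; have [->|zs] := eqVneq z.2 s.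
  rewrite (bigD1 a)//= eqxx !mul1r big1 ?addr0// => b /negbTE ba.
  by rewrite xpair_eqE ba andbF mul0r mulr0.
rewrite big1 => [|b _]; first by rewrite !mul0r.
by rewrite xpair_eqE (negbTE zs) mul0r mulr0.
Qed.

Variables (mb kappab : R).
Hypotheses (hmb : 0 < mb) (hkappab : 0 < kappab < 1)
  (hmixing : forall (x : S) (t : nat),
     dTV nu (nstep (state_kernel M pib) t x) <= mb * kappab ^+ t).

Lemma td_noise_mixing x t z :
  `|kpow behavior_kernel t (fun y => \sum_z' behavior_kernel y z' * td_noise x y z') z|
  <= V * mb * kappab ^+ t.
Proof.
under [X in kpow _ _ X]eq_fun do rewrite td_noise_mean.
set r := pib x.1 x.2 * _.
rewrite (@kpow_state t (fun s => ((s == x.1)%:R - nu x.1) * r)).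
under eq_bigr do rewrite mulrA mulrBr.
rewrite -mulr_suml sumrB (dist_mean_cst _ (nstep_dist t z.2)).
rewrite (bigD1 x.1)//= eqxx mulr1 big1 ?addr0 => [|s /negbTE ->]; last by rewrite mulr0.
have /andP[k0 _] := hkappab.
have r1 : `|r| <= V.
  rewrite normrM ger0_norm ?(pib_policy _).1// -[leRHS]mul1r.
  by apply: ler_pM => //; [exact: (pib_policy _).1|exact: dist_le1|exact: bellman_residual_norm].
rewrite normrM mulrC -mulrA; apply: ler_pM => //.
rewrite distrC (le_trans _ (hmixing z.2 t))//.
exact: dist_le_dTV (nstep_dist _ _).
Qed.

(** From [pathE_pathsum_sqr] with c = 2 V, d = V mb and q = kappab: c^2 + 2 c d / (1 - q) = 4 V^2 (1
    + mb / (1 - kappab)), summed over the |S||A| entries. *)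
Definition noise_const : R := 4 * #|S|%:R * #|A|%:R / (1 - discount M) ^+ 2
  * (1 + mb / (1 - kappab)).

(** Uniform in the start [z], hence usable conditionally on everything before the batch. *)
Lemma pathE_td_noise n z : (0 < n)%N ->
  pathE behavior_kernel n z (fun l =>
    infnorm (fun x => n%:R^-1 * pathsum (td_noise x) z l))
  <= Num.sqrt noise_const * (Num.sqrt n%:R)^-1.
Proof.
move=> n0; have n0' : 0 < n%:R :> R by rewrite ltr0n.
have /andP[k0 k1] := hkappab.
have kd := behavior_kernel_dist.
have C0 : 0 <= 1 + mb / (1 - kappab) by rewrite addr_ge0// divr_ge0 ?subr_ge0 ?ltW.
have var x : pathE behavior_kernel n z (fun l => pathsum (td_noise x) z l ^+ 2) <=
    n%:R * (4 * V ^+ 2 * (1 + mb / (1 - kappab))).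
  have := @pathE_pathsum_sqr _ _ _ kd (td_noise x) (2 * V) (V * mb) kappab n z.
  move/(_ _ _ _ _)/le_trans; apply.
  - by rewrite ltW.
  - by rewrite mulr_ge0// ltW.
  - exact: td_noise_norm.
  - exact: td_noise_mixing.
  rewrite ler_pM2l// le_eqVlt; apply/orP; left; apply/eqP.
  by field; rewrite subr_eq0 gt_eqF.
rewrite -sqrtrV// -sqrtrM; last first.
  by rewrite mulr_ge0// mulr_ge0 ?mulr_ge0// invr_ge0 sqr_ge0.
set E := pathE _ _ _ _.
have [E0|E0] := leP E 0; first exact: le_trans E0 (sqrtr_ge0 _).
have -> : E = Num.sqrt (E ^+ 2) by rewrite sqrtr_sqr ger0_norm ?ltW.
apply: ler_wsqrtr.
rewrite (le_trans (pathE_sqr_le kd _ _ _))//.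
apply: (@le_trans _ _ (pathE behavior_kernel n z (fun l => \sum_x n%:R^-1 ^+ 2 * pathsum (td_noise x) z l ^+ 2))).
  apply: le_pathE => // l _.
  have [y yE] := maxf_attained (fun x => `|n%:R^-1 * pathsum (td_noise x) z l|) (z.2, z.1).
  rewrite /infnorm yE real_normK ?num_real// (bigD1 y)//= exprMn lerDl.
  by apply: sumr_ge0 => i _; rewrite mulr_ge0 ?sqr_ge0.
rewrite pathE_sum; under eq_bigr do rewrite pathEZ.
apply: (@le_trans _ _ (\sum_(x : S * A) n%:R^-1 ^+ 2 * (n%:R * (4 * V ^+ 2 * (1 + mb / (1 - kappab)))))).
  by apply: ler_sum => x _; rewrite ler_wpM2l ?sqr_ge0.
rewrite sumr_const card_prod -[leLHS]mulr_natr natrM /noise_const /V exprVn.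
rewrite le_eqVlt; apply/orP; left; apply/eqP; field.
by rewrite !subr_eq0 !gt_eqF// lt0r_neq0.
Qed.

End TDNoise.
End BehaviorChain.

(** * Error recursion *)

Section Infnorm.
Variables (R : realType) (T : finType).
Implicit Types f : T -> R.

Lemma le_infnorm f z : `|f z| <= infnorm f.
Proof. exact: (le_maxf (fun x => `|f x|)). Qed.

Lemma infnorm_le f c (z : T) : (forall x, `|f x| <= c) -> infnorm f <= c.
Proof. exact: (@maxf_le R T (fun x => `|f x|)). Qed.

Lemma infnorm_ge0 f (z : T) : 0 <= infnorm f.
Proof. exact: le_trans (normr_ge0 _) (le_infnorm f z). Qed.

End Infnorm.

Lemma geometric_sumS (R : realType) (r : R) (u : nat -> R) n :
  \sum_(k < n.+1) r ^+ (n.+1 - 1 - k)%N * u k =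
  r * (\sum_(k < n) r ^+ (n - 1 - k)%N * u k) + u n.
Proof.
rewrite big_ord_recr/= subSS subn0 subnn expr0 mul1r mulr_sumr; congr (_ + _).
apply: eq_bigr => k _; rewrite mulrA -exprS; congr (_ ^+ _ * _).
by have := ltn_ord k; case: n k => // n k; rewrite ltnS subSS subn0 => /subSn ->.
Qed.

Lemma pathsum_mkseq (R : realType) (T : finType) (g : T -> T -> R) (y : nat -> T) n :
  pathsum g (y 0%N) (mkseq (fun i => y i.+1) n) = \sum_(t < n) g (y t) (y t.+1).
Proof.
elim: n y => [|n IH] y; first by rewrite big_ord0.
rewrite big_ord_recl /= -(IH (fun i => y i.+1)) /mkseq; congr (_ + pathsum _ _ _).
by rewrite (iotaDl 1 0 n) -map_comp.
Qed.

Lemma pathE_take (R : realType) (T : finType) (k : T -> T -> R) m n z (F : seq T -> R) :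
  (forall z, is_dist (k z)) -> (m <= n)%N ->
  pathE k n z (fun l => F (take m l)) = pathE k m z F.
Proof.
move=> kd mn; rewrite -(subnKC mn) pathE_cat; apply: eq_pathE => l lm.
rewrite -[RHS](pathE_cst kd (n - m) (last z l)); apply: eq_pathE => l' _.
by rewrite take_size_cat.
Qed.

Section TrajectoryFacts.
Variables (R : realType) (T : finType) (d : measure_display)
  (Omega : measurableType d) (Pr : probability Omega R) (Z : nat -> Omega -> T).

Lemma traj_cat m n w :
  traj Z (m + n) w = traj Z m w ++ mkseq (fun t => Z (m + t)%N w) n.
Proof.
rewrite /traj /mkseq iotaD map_cat add0n; congr (_ ++ _).
by rewrite -{1}[m]addn0 iotaDl -map_comp.
Qed.

Lemma measurable_fun_traj (k : T -> T -> R) z0 N n (F : seq T -> R) :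
  chain_law Pr k Z z0 N -> (n <= N)%N ->
  measurable_fun setT (fun w => F (traj Z n w)).
Proof.
move=> law nN.
apply: (@measurable_fun_random_elt _ _ _ (n.-tuple T)
  (fun w => [tuple of mkseq (fun i => Z i w) n]) (fun t => F t)) => t.
rewrite (_ : [set _ | _] = [set w | traj Z n w = t]).
  exact: traj_measurable law nN.
by apply/seteqP; split => w /= => [<-//|wt]; exact: val_inj.
Qed.

End TrajectoryFacts.

Section Run.
Variables (R : realType) (S A : finType) (M : mdp R S A)
  (h : 'rV[R]_#|A| -> \bar R) (K : nat) (pib pi0 : S -> A -> R) (alpha : R)
  (etak : nat -> (S -> A -> R) -> (S -> A -> R) -> R)
  (s0 : S) (B : nat -> nat)
  (d : measure_display) (Omega : measurableType d) (Pr : probability Omega R)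
  (s : nat -> Omega -> S) (a : nat -> Omega -> A)
  (pi Q : nat -> Omega -> S -> A -> R).
Hypotheses (hh : mirror_map h) (halpha : 0 < alpha <= 1)
  (hrun : expected_td_pmd M h K pib pi0 (fun _ => alpha) etak s0 B
            (fun k _ => (B k)%:R^-1) Pr s a pi Q).

Let V := (1 - discount M)^-1.
Let g0 : 0 <= discount M. Proof. by have /andP[] := discount_itv M. Qed.
Let g1 : discount M < 1. Proof. by have /andP[] := discount_itv M. Qed.
Let V0 : 0 <= V. Proof. by rewrite invr_ge0 subr_ge0 ltW. Qed.

(** Interiority must be carried through the induction: it makes the gradient at the current policy
    meaningful for the next step. *)
Lemma run_policy k w : (k <= K.+1)%N ->
  is_policy (pi k w) /\ forall x, (dom h)^° (vec (pi k w x)).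
Proof.
elim: k => [_|k IH]; first rewrite (run_pi_init hrun).
  by split=> [|x]; [exact: run_pi0 hrun|exact: mirror_rint (run_pi0_rint hrun x)].
rewrite ltnS => kK; have [pk ik] := IH (leqW kK).
have act x := run_actor hrun w x kK.
split=> x; first exact: (act x).1.
exact: argmax_dist_interior (pk x) (ik x) (act x).
Qed.

Lemma batch_startS k : batch_start B k.+1 = (batch_start B k + B k)%N.
Proof. exact: big_ord_recr. Qed.

Lemma batch_start_homo k k' : (k <= k')%N -> (batch_start B k <= batch_start B k')%N.
Proof.
move=> /subnKC <-; elim: (k' - k)%N => [|n IH]; first by rewrite addn0.
by rewrite addnS batch_startS (leq_trans IH)// leq_addr.
Qed.

Lemma run_Q_itv k w : (k <= K.+1)%N -> forall x b, 0 <= Q k w x b <= V.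
Proof.
elim: k => [_ x b|k IH]; first by rewrite (run_Q_init hrun) lexx.
rewrite ltnS => kK x b; have Qk := IH (leqW kK).
have [pk _] := @run_policy k.+1 w kK.
rewrite (run_critic hrun)//.
have [c0 c1] := run_weights hrun kK.
set D := \sum_(t < _) _; have /andP[a0 a1] := halpha.
suff /andP[D0 D1] : 0 <= Q k w x b + D <= V.
  have /andP[q0 q1] := Qk x b.
  (* Here alpha <= 1 enters: the new critic is a convex combination of the old one and an average of
     targets. *)
  have -> : Q k w x b + alpha * D = (1 - alpha) * Q k w x b + alpha * (Q k w x b + D) by ring.
  have b0 : 0 <= 1 - alpha by rewrite subr_ge0.
  rewrite addr_ge0 ?mulr_ge0 ?(ltW a0)//=.
  have -> : V = (1 - alpha) * V + alpha * V by ring.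
  by rewrite lerD ?ler_wpM2l// ltW.
have dw : is_dist (fun t : 'I_(B k) => (B k)%:R^-1 : R).
  by split=> [t|]; [exact: c0 (ltn_ord t)|].
rewrite /D -(dist_mean_cst (Q k w x b) dw) -big_split/=.
under eq_bigr do rewrite -mulrDr.
apply/andP; split.
  apply: (dist_mean_ge dw) => t.
  by have /andP[] := td_error_itv pk Qk (s (batch_start B k + t)%N w)
    (a (batch_start B k + t)%N w) (s (batch_start B k + t.+1)%N w) x b.
apply: (dist_mean_le dw) => t.
by have /andP[] := td_error_itv pk Qk (s (batch_start B k + t)%N w)
  (a (batch_start B k + t)%N w) (s (batch_start B k + t.+1)%N w) x b.
Qed.

Section Actor.
Variables (eta : R) (tpi : nat -> Omega -> S -> A -> R).
Hypotheses (heta : 0 < eta)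
  (htpi : forall k w, (k <= K)%N ->
     is_policy (tpi k w) /\ greedy (tpi k w) (Q k w))
  (hetak : forall k w, (k <= K)%N ->
     eta * maxf (fun x => bregman h (tpi k w x) (pi k w x))
     <= etak k (pi k w) (Q k w)).

(** The greedy gap times the step size is at most the divergence of the greedy policy, itself at
    most the step size over eta. The step size cancels, leaving a gap 1 / eta that the discount
    multiplies. *)
Lemma actor_gap k w x b : (k <= K)%N ->
  bellman_opt M (Q k w) x b - discount M / eta
  <= bellman M (pi k.+1 w) (Q k w) x b <= bellman_opt M (Q k w) x b.
Proof.
move=> kK; have [pk ik] := @run_policy k w (leqW kK).
have [pk1 _] := @run_policy k.+1 w kK.
rewrite (le_bellman_opt _ _ _ _ pk1) andbT.
have [tp tg] := htpi w kK; have e0 := run_eta hrun w kK.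
have gap y : maxf (Q k w y) - \sum_b pi k.+1 w y b * Q k w y b <= eta^-1.
  rewrite -tg.
  have := argmax_dist_gap hh (tp y) (ik y) (run_actor hrun w y kK).
  have := le_maxf (fun x => bregman h (tpi k w x) (pi k w x)) y.
  have := hetak w kK.
  set m := maxf _; set e := etak _ _ _; set D := _ - _ => h1 h2 h3.
  rewrite -(ler_pM2l e0) -/e (le_trans h3)// (le_trans h2)//.
  by rewrite ler_pdivlMr// mulrC.
rewrite /bellman_opt /bellman -addrA lerD2l lerBlDr -lerBlDl -mulrBr ler_wpM2l//.
rewrite -sumrB; under eq_bigr do rewrite -mulrBr.
by apply: dist_mean_le => //; exact: transition_dist.
Qed.

End Actor.

Section Trajectory.
(** An arbitrary action completing the initial state to a transition; the kernel reads only the end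
    state. It also witnesses that [A] is nonempty. *)
Variable b0 : A.

Let Z i w := (a i w, s i.+1 w).
Let z0 := (b0, s0).
Let N := batch_start B K.+1.

Lemma last_run_traj n w : (last z0 (traj Z n w)).2 = s n w.
Proof.
case: n => [|n]; last by rewrite /traj mkseqS last_rcons.
by rewrite /= (run_s_init hrun).
Qed.

Lemma history_run_traj n x y w : x 0%N = s0 ->
  history s a n x y w <-> traj Z n w = mkseq (fun i => (y i, x i.+1)) n.
Proof.
move=> x0; split=> [[sx ay]|/mkseq_eqP ZE].
  by apply/mkseq_eqP => i ni; rewrite /Z sx// ay.
split=> i ni; last by case: (ZE i ni).
case: i ni => [_|i ni]; first by rewrite (run_s_init hrun).
by case: (ZE i ni).
Qed.

Lemma run_law : chain_law Pr (behavior_kernel M pib) Z z0 N.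
Proof.
move=> n l z nN sl; split.
  pose F i := [set w | a i w = (nth z0 (rcons l z) i).1] `&`
    [set w | s i.+1 w = (nth z0 (rcons l z) i).2].
  suff -> : [set w | traj Z n.+1 w = rcons l z] = \bigcap_(i in `I_n.+1) F i.
    apply: fin_bigcap_measurable => [|i /= ni]; first exact: finite_II.
    have iN : (i < N)%N by rewrite (leq_trans _ nN).
    apply: measurableI; first exact: (run_a_meas hrun iN).
    exact: (run_s_meas hrun iN).
  rewrite -{1}[rcons l z](mkseq_nth z0) size_rcons sl.
  apply/seteqP; split => w /=.
    by move/mkseq_eqP => ZE i /= ni; split; rewrite /= -ZE.
  move=> wZ; apply/mkseq_eqP => i ni; have [aE sE] := wZ i ni.
  by rewrite /Z [s i.+1 w]sE [a i w]aE -surjective_pairing.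
pose x i := (nth z0 (z0 :: rcons l z) i).2; pose y i := (nth z0 (rcons l z) i).1.
have lzE : mkseq (fun i => (y i, x i.+1)) n.+1 = rcons l z.
  rewrite -[RHS](mkseq_nth z0) size_rcons sl; apply: eq_mkseq => i.
  by rewrite /x /y /= -surjective_pairing.
have lE : mkseq (fun i => (y i, x i.+1)) n = l.
  by move: lzE; rewrite mkseqS => /rcons_inj[].
have hE m : [set w | traj Z m w = mkseq (fun i => (y i, x i.+1)) m] = history s a m x y.
  by apply/seteqP; split => w /=; rewrite history_run_traj.
rewrite -lzE -lE !hE (run_sample_state hrun nN) (run_sample_action hrun nN).
rewrite -muleA -EFinM lE /behavior_kernel.
have -> : x n = (last z0 l).2.
  by rewrite /x -rcons_cons nth_rcons /= sl ltnSn (last_nth z0) sl.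
have -> : x n.+1 = z.2 by rewrite /x /= nth_rcons sl ltnn eqxx.
by have -> : y n = z.1 by rewrite /y nth_rcons sl ltnn eqxx.
Qed.

(** The substitute for adaptedness. It includes the policy of index k + 1 because the actor moves
    before batch k is sampled. *)
Lemma run_nonanticipative k w w' : (k <= K)%N ->
  traj Z (batch_start B k) w = traj Z (batch_start B k) w' ->
  [/\ pi k w = pi k w', Q k w = Q k w' & pi k.+1 w = pi k.+1 w'].
Proof.
move=> kK ww'.
have actor k' : (k' <= K)%N -> pi k' w = pi k' w' -> Q k' w = Q k' w' ->
    pi k'.+1 w = pi k'.+1 w'.
  move=> k'K pE QE; apply/funext => x; have := run_actor hrun w x k'K.
  rewrite pE QE => act; exact: (argmax_dist_unique hh act (run_actor hrun w' x k'K)).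
suff [pE QE] : pi k w = pi k w' /\ Q k w = Q k w' by split=> //; exact: actor.
elim: k kK ww' => [|k IH] kK ww'.
  rewrite !(run_pi_init hrun); split=> //.
  by apply/funext => x; apply/funext => b; rewrite !(run_Q_init hrun).
have /mkseq_eqP ZE := ww'.
have kK' := ltnW kK.
have [pE QE] : pi k w = pi k w' /\ Q k w = Q k w'.
  apply: IH => //; apply/mkseq_eqP => i ik; apply: ZE.
  by rewrite (leq_trans ik)// batch_start_homo.
have pE1 := actor k kK' pE QE; split=> //.
have sE i : (i <= batch_start B k.+1)%N -> s i w = s i w'.
  case: i => [_|i /ZE]; first by rewrite !(run_s_init hrun).
  by rewrite /Z => -[].
apply/funext => x; apply/funext => b; rewrite !(run_critic hrun _ _ _ kK') QE pE1.
congr (_ + _ * _); apply: eq_bigr => t _; congr (_ * td_error _ _ _ _ _ _ _ _).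
- by apply: sE; rewrite batch_startS leq_add2l ltnW.
- have tk : (batch_start B k + t < batch_start B k.+1)%N by rewrite batch_startS ltn_add2l.
  by have := ZE _ tk; rewrite /Z => -[].
- by apply: sE; rewrite batch_startS leq_add2l.
Qed.

Variable nu : S -> R.

Definition batch_noise k w (x : S * A) : R :=
  (B k)%:R^-1 * pathsum (td_noise M pib (pi k.+1 w) (Q k w) nu x)
    (last z0 (traj Z (batch_start B k) w))
    (mkseq (fun t => Z (batch_start B k + t)%N w) (B k)).

Lemma criticE k w x b : (k <= K)%N ->
  Q k.+1 w x b = Q k w x b
    + alpha * (nu x * pib x b * (bellman M (pi k.+1 w) (Q k w) x b - Q k w x b)
               + batch_noise k w (x, b)).
Proof.
move=> kK; rewrite (run_critic hrun)//; congr (_ + _ * _).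
rewrite -mulr_sumr /batch_noise.
pose y t := last z0 (traj Z (batch_start B k + t)%N w).
have yS t : y t.+1 = Z (batch_start B k + t)%N w.
  by rewrite /y addnS /traj mkseqS last_rcons.
rewrite -[X in last z0 (traj Z X w)]addn0 -/(y 0%N).
under [X in pathsum _ _ X]eq_mkseq do rewrite -yS.
rewrite pathsum_mkseq sumrB sumr_const card_ord -mulr_natr.
have Bk : (B k)%:R != 0 :> R by rewrite pnatr_eq0 -lt0n (run_batch hrun).
have -> : \sum_(t < B k) td_error M (pi k.+1 w) (Q k w)
    (s (batch_start B k + t)%N w) (a (batch_start B k + t)%N w)
    (s (batch_start B k + t.+1)%N w) x b =
  \sum_(t < B k) td_error M (pi k.+1 w) (Q k w) (y t).2 (y t.+1).1 (y t.+1).2 x b.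
  by apply: eq_bigr => t _; rewrite yS /= last_run_traj addnS.
by rewrite /=; field.
Qed.

(** The iterates are read at any outcome having the given prefix; the choice is immaterial by
    [run_nonanticipative]. For a prefix that never occurs [get] returns a default outcome, whose
    iterates obey the same bounds. *)
Definition path_noise k (l : seq (A * S)) : R :=
  let w := get [set w | traj Z (batch_start B k) w = take (batch_start B k) l] in
  infnorm (fun x => (B k)%:R^-1 *
    pathsum (td_noise M pib (pi k.+1 w) (Q k w) nu x)
      (last z0 (take (batch_start B k) l)) (drop (batch_start B k) l)).

Lemma batch_noiseE k w : (k <= K)%N ->
  infnorm (batch_noise k w) = path_noise k (traj Z (batch_start B k.+1) w).
Proof.
move=> kK; rewrite /path_noise batch_startS traj_cat.
rewrite take_size_cat ?size_traj// drop_size_cat ?size_traj//.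
set w' := xget _ _.
have ww' : traj Z (batch_start B k) w' = traj Z (batch_start B k) w.
  by apply: (@xgetPex _ _ [set w' | traj Z (batch_start B k) w' = traj Z (batch_start B k) w]); exists w.
by have [_ -> ->] := run_nonanticipative kK ww'.
Qed.

Variables (mb kappab : R).
Hypotheses (hmb : 0 < mb) (hkappab : 0 < kappab < 1)
  (hmixing : forall (x : S) (t : nat),
     dTV nu (nstep (state_kernel M pib) t x) <= mb * kappab ^+ t)
  (nu_dist : is_dist nu).

Let kd := behavior_kernel_dist M (run_pib hrun).
Let C := Num.sqrt (noise_const M mb kappab).

(** Once the prefix is fixed, policy and critic are frozen and the batch is a fresh chain started at
    the last transition. *)
Lemma pathE_path_noise k : (k <= K)%N ->
  pathE (behavior_kernel M pib) (batch_start B k.+1) z0 (path_noise k)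
  <= C * (Num.sqrt (B k)%:R)^-1.
Proof.
move=> kK; rewrite batch_startS pathE_cat; apply: (pathE_le kd) => l lk.
rewrite /path_noise; set w := get [set w | traj Z (batch_start B k) w = l].
rewrite (@eq_pathE _ _ _ _ _ _ (fun l' => infnorm (fun x => (B k)%:R^-1 *
    pathsum (td_noise M pib (pi k.+1 w) (Q k w) nu x) (last z0 l) l'))); last first.
  by move=> l' _; rewrite take_size_cat// drop_size_cat.
apply: pathE_td_noise => //.
- exact: run_pib hrun.
- exact: (@run_policy k.+1 w kK).1.
- exact: run_Q_itv (leqW kK).
- exact: (run_batch hrun kK).
Qed.

Variables (eta : R) (tpi : nat -> Omega -> S -> A -> R).
Hypotheses (heta : 0 < eta)
  (htpi : forall k w, (k <= K)%N ->
     is_policy (tpi k w) /\ greedy (tpi k w) (Q k w))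
  (hetak : forall k w, (k <= K)%N ->
     eta * maxf (fun x => bregman h (tpi k w x) (pi k w x))
     <= etak k (pi k w) (Q k w)).

Let sigma := minf (fun x : S * A => nu x.1 * pib x.1 x.2).
Let rho := 1 - (1 - discount M) * alpha * sigma.
Hypothesis sigma_gt0 : 0 < sigma.

Let weight_itv x : sigma <= nu x.1 * pib x.1 x.2 <= 1.
Proof.
rewrite (minf_le (fun x : S * A => nu x.1 * pib x.1 x.2))/=.
have [[n0 _] [p0 _]] := (nu_dist, run_pib hrun x.1).
by rewrite mulr_ile1 ?dist_le1//; exact: run_pib hrun _.
Qed.

Let sigma_le1 : sigma <= 1.
Proof. by have /andP[w0 w1] := weight_itv (s0, b0); exact: le_trans w1. Qed.

Let A0 : (0 < #|A|)%N. Proof. by apply/card_gt0P; exists b0. Qed.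

Definition critic_error k w : R :=
  infnorm (fun x : S * A => Qstar M x.1 x.2 - Q k w x.1 x.2).

Let critic_error_ge0 k w : 0 <= critic_error k w.
Proof. exact: infnorm_ge0 (s0, b0). Qed.

Let le_critic_error k w x b : `|Qstar M x b - Q k w x b| <= critic_error k w.
Proof. exact: (le_infnorm (fun x : S * A => Qstar M x.1 x.2 - Q k w x.1 x.2) (x, b)). Qed.

Lemma Qstar_actor k w x b : (k <= K)%N ->
  `|Qstar M x b - bellman M (pi k.+1 w) (Q k w) x b|
  <= discount M * critic_error k w + discount M / eta.
Proof.
move=> kK; have /andP[l u] := actor_gap heta htpi hetak w x b kK.
have := @bellman_opt_norm _ _ _ M (Qstar M) (Q k w) _ x b (le_critic_error k w).
rewrite -Qstar_fixpoint// !ler_norml => /andP[? ?].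
have : 0 <= discount M / eta by rewrite divr_ge0// ltW.
by move=> ?; apply/andP; split; lra.
Qed.

(** Each entry is a convex combination with weight alpha wt. The contraction uses wt >= sigma,
    whereas the actor bias uses only wt <= 1. *)
Lemma critic_error_step k w : (k <= K)%N ->
  critic_error k.+1 w <= rho * critic_error k w + alpha * (discount M / eta)
    + alpha * infnorm (batch_noise k w).
Proof.
move=> kK; apply: (infnorm_le (s0, b0)) => -[x b] /=; rewrite criticE//.
have /andP[al0 al1] := halpha.
have /andP[wl wu] := weight_itv (x, b); rewrite /= in wl wu.
have := Qstar_actor w x b kK; have := le_critic_error k w x b.
have := le_infnorm (batch_noise k w) (x, b); have := critic_error_ge0 k w.
set e := critic_error k w; set nn := infnorm _; set n := batch_noise _ _ _.
set q := Qstar M x b; set Qk := Q k w x b; set T := bellman _ _ _ _ _.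
set wt := nu x * pib x b in wl wu *; set de := discount M / eta.
move=> e0 nle qQ qT.
have de0 : 0 <= de by rewrite divr_ge0// ltW.
have -> : q - (Qk + alpha * (wt * (T - Qk) + n)) =
  (1 - alpha * wt) * (q - Qk) + alpha * wt * (q - T) - alpha * n by ring.
have aw0 : 0 <= alpha * wt by rewrite mulr_ge0 ?(ltW al0)// (le_trans (ltW sigma_gt0)).
have aw1 : alpha * wt <= 1.
  by rewrite mulr_ile1// ?(ltW al0)// (le_trans (ltW sigma_gt0)).
rewrite (le_trans (ler_normB _ _))// (le_trans (lerD (ler_normD _ _) (lexx _)))//.
rewrite [`|(1 - _) * _|]normrM [`|alpha * wt * _|]normrM [`|alpha * n|]normrM.
rewrite (ger0_norm aw0) (gtr0_norm al0) [`|1 - _|]ger0_norm ?subr_ge0//.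
have h1 : (1 - alpha * wt) * `|q - Qk| <= (1 - alpha * wt) * e.
  by rewrite ler_wpM2l ?subr_ge0.
have h2 : alpha * wt * `|q - T| <= alpha * wt * (discount M * e + de) by rewrite ler_wpM2l.
have h3 : alpha * `|n| <= alpha * nn by rewrite ler_wpM2l// ltW.
have h4 : alpha * wt * de <= alpha * de.
  by rewrite -mulrA ler_wpM2l ?(ltW al0)// ler_piMl.
have h5 : (1 - discount M) * alpha * e * sigma <= (1 - discount M) * alpha * e * wt.
  by rewrite ler_wpM2l// !mulr_ge0 ?subr_ge0 ?(ltW g1) ?(ltW al0).
rewrite /rho; lra.
Qed.

Let rho_itv : 0 <= rho <= 1.
Proof.
have /andP[al0 al1] := halpha.
have m0 : 0 <= (1 - discount M) * alpha * sigma.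
  by rewrite !mulr_ge0 ?subr_ge0// ltW.
have m1 : (1 - discount M) * alpha * sigma <= 1.
  rewrite mulr_ile1 ?(ltW sigma_gt0)//; first by rewrite mulr_ge0 ?subr_ge0// ltW.
  by rewrite mulr_ile1 ?subr_ge0 ?(ltW g1) ?(ltW al0)// gerBl.
by rewrite /rho; apply/andP; split; lra.
Qed.

Lemma critic_error_le n w : (n <= K.+1)%N ->
  critic_error n w <= rho ^+ n * V + discount M / (eta * (1 - discount M) * sigma)
    + alpha * \sum_(k < n) rho ^+ (n - 1 - k)%N * infnorm (batch_noise k w).
Proof.
have /andP[al0 al1] := halpha; have /andP[r0 r1] := rho_itv.
(* [D] is the fixed point of the map t |-> rho t + alpha gamma / eta, so the bias does not
   accumulate along the induction. *)
set D := discount M / _.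
elim: n => [_|n IH].
  rewrite big_ord0 mulr0 addr0 expr0 mul1r; apply: (infnorm_le (s0, b0)) => -[x b] /=.
  rewrite (run_Q_init hrun) subr0; have /andP[q0 q1] := Qstar_itv M A0 x b.
  rewrite ger0_norm// (le_trans q1)// lerDl divr_ge0// !mulr_ge0 ?subr_ge0// ltW//.
rewrite ltnS => nK; rewrite (le_trans (critic_error_step w nK))//.
have := ler_wpM2l r0 (IH (leqW nK)).
rewrite (geometric_sumS rho (fun k => infnorm (batch_noise k w))) exprS.
have DE : rho * D + alpha * (discount M / eta) = D.
  rewrite /rho /D; field.
  by rewrite subr_eq0 !gt_eqF.
set su := \sum_(_ < _) _; lra.
Qed.

(** The critic error enters twice: in replacing the critic by [Qstar] under the new policy's
    operator, and in comparing that operator with the optimal one. The remaining distance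
    contracts. *)
Lemma actor_error_le n w : (n <= K)%N ->
  infnorm (fun x : S * A => Qstar M x.1 x.2 - Qval M (pi n.+1 w) x.1 x.2)
  <= (2 * discount M * critic_error n w + discount M / eta) / (1 - discount M).
Proof.
move=> nK; have [pn _] := @run_policy n.+1 w nK.
apply: (infnorm_le (s0, b0)) => z.
rewrite ger0_norm ?subr_ge0 ?Qval_le_Qstar//.
apply: (@contraction_bound R (S * A)%type
  (fun z => Qstar M z.1 z.2 - Qval M (pi n.+1 w) z.1 z.2) _ _ (discount_itv M)).
move=> m qm [x b] /=.
have := Qstar_actor w x b nK; rewrite ler_norml => /andP[_ h1].
have h2 : bellman M (pi n.+1 w) (Q n w) x b - bellman M (pi n.+1 w) (Qstar M) x b
    <= discount M * critic_error n w.
  apply: bellmanB_le => // y c; have := le_critic_error n w y c.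
  by rewrite ler_norml => /andP[? _]; lra.
have h3 := @bellmanB_le _ _ _ M (pi n.+1 w) (Qstar M) (Qval M (pi n.+1 w)) m x b pn
  (fun y c => qm (y, c)).
rewrite [Qval _ _ x b]Qval_bellman//; lra.
Qed.

Lemma expected_actor_error n : (n <= K)%N ->
  ('E_Pr[fun w => infnorm (fun x : S * A =>
           Qstar M x.1 x.2 - Qval M (pi n.+1 w) x.1 x.2)%R]
   <= ((2 * discount M * (rho ^+ n * V
          + discount M / (eta * (1 - discount M) * sigma) + alpha * (C * Xi rho B n))
        + discount M / eta) / (1 - discount M))%R%:E)%E.
Proof.
move=> nK; have /andP[al0 al1] := halpha; have /andP[r0 r1] := rho_itv.
pose bs := batch_start B.
have nN : (bs n <= N)%N by apply: batch_start_homo; exact: leqW.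
pose X w := infnorm (fun x : S * A => Qstar M x.1 x.2 - Qval M (pi n.+1 w) x.1 x.2).
(* Factoring the error through the finite trajectory is what makes it measurable. *)
pose FX l := X (get [set w | traj Z (bs n) w = l]).
have XE w : X w = FX (traj Z (bs n) w).
  rewrite /FX; set w' := xget _ _.
  have ww' : traj Z (bs n) w' = traj Z (bs n) w.
    by apply: (@xgetPex _ _ [set w' | traj Z (bs n) w' = traj Z (bs n) w]); exists w.
  by rewrite /X; have [_ _ ->] := run_nonanticipative nK ww'.
pose G (S : R) := (2 * discount M * (rho ^+ n * V
          + discount M / (eta * (1 - discount M) * sigma) + alpha * S)
        + discount M / eta) / (1 - discount M).
pose SY l := \sum_(k < n) rho ^+ (n - 1 - k)%N * path_noise k (take (bs k.+1) l).
pose FY l := G (SY l).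
have GS (S1 S2 : R) : S1 <= S2 -> G S1 <= G S2.
  move=> S12; rewrite ler_wpM2r ?invr_ge0 ?subr_ge0 ?(ltW g1)// lerD2r ler_wpM2l ?mulr_ge0//.
  by rewrite lerD2l ler_wpM2l// ltW.
have XY w : X w <= FY (traj Z (bs n) w).
  rewrite (le_trans (actor_error_le w nK))// /FY.
  have -> : SY (traj Z (bs n) w) = \sum_(k < n) rho ^+ (n - 1 - k)%N * infnorm (batch_noise k w).
    apply: eq_bigr => k _; have kn := ltn_ord k.
    rewrite batch_noiseE ?(leq_trans (ltnW kn))//; congr (_ * path_noise _ _).
    by rewrite -[bs n](subnKC (batch_start_homo kn)) traj_cat take_size_cat ?size_traj.
  have := critic_error_le w (leqW nK); rewrite /G => ce.
  rewrite ler_wpM2r ?invr_ge0 ?subr_ge0 ?(ltW g1)// lerD2r ler_wpM2l ?mulr_ge0//.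
have X0 w : 0 <= X w by exact: infnorm_ge0 (s0, b0).
have law := run_law.
rewrite (@le_trans _ _ ('E_Pr[fun w => FY (traj Z (bs n) w)])%E)//.
  apply: expectation_le => //.
  - rewrite (_ : (fun _ => _) = (fun w => FX (traj Z (bs n) w))); last first.
      by apply/funext => w; exact: XE.
    exact: measurable_fun_traj law nN.
  - exact: measurable_fun_traj law nN.
  - by move=> w; rewrite (le_trans (X0 w)).
  - by apply: aeW.
rewrite (expectation_traj FY law nN) lee_fin.
have -> : pathE (behavior_kernel M pib) (bs n) z0 FY =
    G (pathE (behavior_kernel M pib) (bs n) z0 SY).
  (* [G] is affine, so it commutes with the expectation. *)
  set c1 := 2 * discount M * alpha / (1 - discount M).
  have GE S1 : G S1 = c1 * S1 + G 0.
    by rewrite /G /c1; field; rewrite subr_eq0 !gt_eqF.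
  rewrite GE -pathEZ -[X in _ + X](pathE_cst kd (bs n) z0) -pathED.
  by apply: eq_pathE => l _; rewrite -GE.
apply: GS; rewrite pathE_sum /Xi mulr_sumr; apply: ler_sum => k _.
rewrite pathEZ mulrCA ler_wpM2l ?exprn_ge0//.
have kn := ltn_ord k.
rewrite (pathE_take _ _ kd) ?batch_start_homo//.
exact: pathE_path_noise (leq_trans (ltnW kn) nK).
Qed.

End Trajectory.
End Run.

Theorem theorem3p17 (R : realType) (S A : finType)
  (hS : (0 < #|S|)%N) (hA : (0 < #|A|)%N)
  (M : mdp R S A)
  (h : 'rV[R]_#|A| -> \bar R) (hh : mirror_map h)
  (K : nat) (hK : (1 <= K)%N)
  (pib pi0 : S -> A -> R)
  (alpha : R) (halpha : 0 < alpha <= 1)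
  (etak : nat -> (S -> A -> R) -> (S -> A -> R) -> R)
  (s0 : S) (B : nat -> nat)
  (d : measure_display) (Omega : measurableType d) (Pr : probability Omega R)
  (s : nat -> Omega -> S) (a : nat -> Omega -> A)
  (pi Q : nat -> Omega -> S -> A -> R)
  (hrun : expected_td_pmd M h K pib pi0 (fun _ => alpha) etak s0 B
            (fun k _ => (B k)%:R^-1) Pr s a pi Q)
  (hpib : 0 < minf (fun x : S * A => pib x.1 x.2))
  (hergodic : ergodic_chain (state_kernel M pib))
  (nu : S -> R) (hnu : is_stationary (state_kernel M pib) nu)
  (mb kappab : R) (hmb : 0 < mb) (hkappab : 0 < kappab < 1)
  (hmixing : forall (x : S) (t : nat),
     dTV nu (nstep (state_kernel M pib) t x) <= mb * kappab ^+ t)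
  (eta : R) (heta : 0 < eta)
  (tpi : nat -> Omega -> S -> A -> R)
  (htpi : forall k w, (k <= K)%N ->
     is_policy (tpi k w) /\ greedy (tpi k w) (Q k w))
  (hetak : forall k w, (k <= K)%N ->
     eta * maxf (fun x => bregman h (tpi k w x) (pi k w x))
     <= etak k (pi k w) (Q k w)) :
  let gamma := discount M in
  let sigma := minf (fun x : S * A => nu x.1 * pib x.1 x.2) in
  let rho := 1 - (1 - gamma) * alpha * sigma in
  ('E_Pr[fun w => infnorm (fun x : S * A =>
                    Qstar M x.1 x.2 - Qval M (pi K w) x.1 x.2)%R]
   <= (2 / (alpha * sigma * (1 - gamma) ^+ 2) * rho ^+ (K - 1)%N
       + 2 * gamma / (alpha * eta * (1 - gamma) ^+ 2 * sigma ^+ 2)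
       + (sigma * (1 - gamma))^-1
         * Num.sqrt (4 * #|S|%:R * #|A|%:R / (1 - gamma) ^+ 2
                     * (1 + mb / (1 - kappab)))
         * (Xi rho B K + Xi rho B (K - 1)%N
            + (Num.sqrt (B (K - 1)%N)%:R)^-1))%R%:E)%E.
Proof.
cbv zeta; set gamma := discount M.
set sigma := minf (fun x : S * A => nu x.1 * pib x.1 x.2).
set rho := 1 - (1 - gamma) * alpha * sigma.
have /card_gt0P[b0 _] := hA.
have sigma0 : 0 < sigma.
  have [[x b] sigmaE] := minf_attained (fun x : S * A => nu x.1 * pib x.1 x.2) (s0, b0).
  rewrite /sigma sigmaE mulr_gt0 ?(stationary_pos (run_pib hrun) _ hergodic.1 hnu)//=.
  exact: lt_le_trans hpib (minf_le (fun x : S * A => pib x.1 x.2) (x, b)).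
have /andP[g0 g1] : 0 <= gamma < 1 := discount_itv M.
(* With K = n + 1 the final policy is the one computed from the critic of index n, hence the
   exponent K - 1. *)
case: K hK hrun htpi hetak => // n _ hrun' htpi' hetak'; rewrite subn1/=.
apply: (le_trans (expected_actor_error hh halpha hrun' b0 hmb hkappab hmixing hnu.1
  heta htpi' hetak' sigma0 (leqnSn n))).
rewrite lee_fin -/gamma -/sigma -/rho.
rewrite /noise_const -/gamma.
set C := Num.sqrt (4 * _ * _ / _ * _).
have XiS : Xi rho B n.+1 = rho * Xi rho B n + (Num.sqrt (B n)%:R)^-1.
  exact: (geometric_sumS rho (fun k => (Num.sqrt (B k)%:R)^-1)).
rewrite XiS.
have C0 : 0 <= C := sqrtr_ge0 _.
have sq0 : 0 <= (Num.sqrt (B n)%:R)^-1 :> R by rewrite invr_ge0 sqrtr_ge0.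
set X := Xi rho B n; set b := (Num.sqrt _)^-1 in sq0 *; set rn := rho ^+ n.
have /andP[al0 al1] := halpha.
have sigma1 : sigma <= 1.
  rewrite (le_trans (minf_le (fun x : S * A => nu x.1 * pib x.1 x.2) (s0, b0)))//=.
  have [[nu0 _] [p0 _]] := (hnu.1, run_pib hrun' s0).
  by rewrite mulr_ile1 ?dist_le1//; [exact: hnu.1|exact: run_pib hrun' s0].
have u0 : 0 < 1 - gamma by rewrite subr_gt0.
have as1 : alpha * sigma <= 1 by rewrite mulr_ile1 ?(ltW al0) ?(ltW sigma0).
have as0 : 0 <= alpha * sigma by rewrite mulr_ge0 ?(ltW al0) ?(ltW sigma0).
have rho0 : 0 <= rho.
  by rewrite subr_ge0 -mulrA mulr_ile1 ?mulr_ge0 ?(ltW al0) ?(ltW sigma0) ?(ltW u0)// gerBl.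
have rn0 : 0 <= rn := exprn_ge0 n rho0.
have X0 : 0 <= X.
  by apply: sumr_ge0 => k _; rewrite mulr_ge0 ?exprn_ge0 ?invr_ge0 ?sqrtr_ge0.
have nz : [&& 1 - gamma != 0, eta != 0, alpha != 0 & sigma != 0] by rewrite !gt_eqF.
have /and4P[nu1 neta nal nsi] := nz.
(* The first two summands become the stated ones times factors at most 1; the third is arranged for
   comparison with the bracket of [Xi] terms. *)
have -> : (2 * gamma * (rn * (1 - gamma)^-1 + gamma / (eta * (1 - gamma) * sigma)
      + alpha * (C * X)) + gamma / eta) / (1 - gamma) =
   (alpha * sigma * gamma) * (2 / (alpha * sigma * (1 - gamma) ^+ 2) * rn)
   + alpha * sigma * (gamma + 2^-1 * (1 - gamma) * sigma)
     * (2 * gamma / (alpha * eta * (1 - gamma) ^+ 2 * sigma ^+ 2))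
   + (sigma * (1 - gamma))^-1 * C * (2 * gamma * (alpha * sigma) * X).
  by field; rewrite nu1 neta nal nsi.
apply: lerD; first apply: lerD.
- apply: ler_piMl; last by rewrite mulr_ile1 ?as0 ?(ltW g1).
  by rewrite mulr_ge0// divr_ge0// mulr_ge0 ?sqr_ge0.
- apply: ler_piMl.
    apply: divr_ge0; first exact: mulr_ge0.
    by rewrite !mulr_ge0 ?sqr_ge0 ?(ltW al0) ?(ltW heta) ?(ltW u0) ?(ltW sigma0).
  have us0 : 0 <= (1 - gamma) * sigma by rewrite mulr_ge0 ?(ltW u0) ?(ltW sigma0).
  have us1 : (1 - gamma) * sigma <= 1 - gamma by rewrite ler_piMr ?(ltW u0).
  by rewrite mulr_ile1//; lra.
- rewrite ler_wpM2l ?mulr_ge0 ?invr_ge0 ?mulr_ge0 ?(ltW sigma0) ?(ltW u0)//.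
  (* By [XiS] the stated bracket equals (1 + rho) X + 2 b. Since 1 + rho = 2 - (1 - gamma) alpha
     sigma, the claim amounts to (1 + gamma) alpha sigma <= 2. *)
  have : 2 * gamma * (alpha * sigma) * X <= (1 + rho) * X.
    by rewrite ler_wpM2r// /rho; have := ler_wpM2l g0 as1; lra.
  lra.
Qed.
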